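(* Let $n\ge 2$, $d\ge 1$, let $k\ge 0$ be an integer, and let $\Omega\subset\mathbb{R}^d$ be compact. Suppose that $f:\Omega^n\to\mathbb{R}$ is $n$-antisymmetric and $\mathcal{C}^k$. Then for every $\epsilon>0$ there exists an $n$-antisymmetric polynomial $P$ (a real polynomial in the $dn$ coordinates of $(\mathbb{R}^d)^n$) such that $$\|f-P\|_{\mathcal{C}^k(\Omega^n)}<\epsilon .$$
   Context: Points of $(\mathbb{R}^d)^n$ are written $\boldsymbol{x}=(\boldsymbol{x}_1,\dots,\boldsymbol{x}_n)$ with $\boldsymbol{x}_i\in\mathbb{R}^d$. For $\sigma$ in the symmetric group $\mathcal{S}_n$, $\sigma.\boldsymbol{x}:=(\boldsymbol{x}_{\sigma(1)},\dots,\boldsymbol{x}_{\sigma(n)})$. A function $f$ is $n$-antisymmetric if $f(\sigma.\boldsymbol{x})=\mathrm{sgn}(\sigma)f(\boldsymbol{x})$ for all $\sigma\in\mathcal{S}_n$ and all $\boldsymbol{x}$ in its domain, where $\mathrm{sgn}(\sigma)$ is the sign of $\sigma$. For compact $V\subset(\mathbb{R}^d)^n$, pick any open set $U$ with $V\subset U\subseteq(\mathbb{R}^d)^n$ and put $\mathcal{C}^k(V)=\{F|_V: F\in\mathcal{C}^k(U)\}$, where $\mathcal{C}^k(U)$ is the set of $k$ times continuously differentiable real functions on $U$; this space is regarded as independent of the choice of $U$. The norm is given by the maxima of the continuous derivatives up to order $k$, restricted to $V$: $$\|p\|_{\mathcal{C}^k(V)}:=\sum_{|\alpha|\le k}\max_{\boldsymbol{x}\in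 V}|(D^\alpha p)(\boldsymbol{x})|,$$ with $\alpha\in\mathbb{Z}_{\ge0}^{dn}$ a multi-index.
   Formalization: The C^k norm is the infimum of the stated sum of maxima over all C^k extensions, since derivatives on Omega^n need not be determined by values there (e.g. Omega a single point); it equals the stated formula whenever they are determined. *)

(* Defs.v *)
From mathcomp Require Import all_boot all_order all_algebra all_fingroup.
From mathcomp Require Import all_classical all_reals all_analysis.
From mathcomp Require mpoly.
Import (canonicals, coercions) mpoly.

Set Implicit Arguments.
Unset Strict Implicit.
Unset Printing Implicit Defensive.

Import Order.TTheory GRing.Theory Num.Theory.
Import numFieldNormedType.Exports.

Local Open Scope classical_set_scope.
Local Open Scope ring_scope.

(* A point (x_1, ..., x_n) of (R^d)^n is the matrix 'M[R]_(n, d) whose i-th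
   row is x_i.  Its n * d scalar coordinates are indexed through mxvec, and
   row_perm s x = (x_(s 1), ..., x_(s n)). *)

Definition cartesian_power (R : realType) (n d : nat) (Omega : set 'rV[R]_d)
  : set 'M[R]_(n, d) := [set x | forall i : 'I_n, Omega (row i x)].
Arguments cartesian_power {R} n {d} Omega _.

Definition antisymmetric_on (R : realType) (n d : nat) (V : set 'M[R]_(n, d))
    (f : 'M[R]_(n, d) -> R) : Prop :=
  forall (s : 'S_n) (x : 'M[R]_(n, d)),
    V x -> f (row_perm s x) = (-1) ^+ s * f x.

Definition poly_fun (R : realType) (n d : nat) (p : mpoly.mpoly (n * d) R)
  : 'M[R]_(n, d) -> R := fun x => mpoly.meval (fun c => mxvec x 0 c) p.

Definition coord_vec (R : realType) (n d : nat) (c : 'I_(n * d))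
  : 'M[R]_(n, d) := vec_mx (delta_mx 0 c).

Definition partial (R : realType) (n d : nat) (c : 'I_(n * d))
    (f : 'M[R]_(n, d) -> R) : 'M[R]_(n, d) -> R :=
  fun x => 'D_(coord_vec R c) f x.

(* The partial derivatives are taken in the order of the coordinates; for a
   function that is C^k with k >= |alpha| the order does not matter. *)
Definition multi_deriv (R : realType) (n d : nat)
    (alpha : mpoly.multinom (n * d)) (f : 'M[R]_(n, d) -> R)
  : 'M[R]_(n, d) -> R :=
  foldr (fun c g => iter (alpha c) (partial c) g)
    f (enum 'I_(n * d)).

(* Meant for open U. *)
Fixpoint Ck_on (R : realType) (n d k : nat) (U : set 'M[R]_(n, d))
    (F : 'M[R]_(n, d) -> R) : Prop :=
  (forall x, U x -> {for x, continuous F}) /\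
  match k with
  | 0%N => True
  | k'.+1 => forall c : 'I_(n * d),
      (forall x, U x -> derivable F x (coord_vec R c)) /\
      Ck_on k' U (partial c F)
  end.

Definition Ck_extension (R : realType) (n d k : nat) (V : set 'M[R]_(n, d))
    (f : 'M[R]_(n, d) -> R) (F : 'M[R]_(n, d) -> R) : Prop :=
  exists U : set 'M[R]_(n, d),
    [/\ open U, V `<=` U, Ck_on k U F & forall x, V x -> F x = f x].

(* Only the values of f on V matter. *)
Definition Ck_fun (R : realType) (n d k : nat) (V : set 'M[R]_(n, d))
    (f : 'M[R]_(n, d) -> R) : Prop :=
  exists F : 'M[R]_(n, d) -> R, Ck_extension k V f F.

(* On a compact V, for F of class C^k near V, the suprema are maxima (and the
   supremum over the empty set is 0). *)
Definition sum_max_derivs (R : realType) (n d k : nat) (V : set 'M[R]_(n, d))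
    (F : 'M[R]_(n, d) -> R) : R :=
  \sum_(alpha : mpoly.bmultinom (n * d) k.+1)
    sup [set `|multi_deriv alpha F x| | x in V].

(* Distinct C^k extensions of f may have distinct derivatives on V (e.g. if V
   is finite), so that the formula above does not by itself define a function
   of f.  The norm of f in C^k(V) is the infimum over all extensions, that is,
   the norm of the quotient of C^k functions near V by those vanishing on V.
   It is +oo if f is not C^k on V, and it is the formula above whenever the
   derivatives on V are determined by the values on V, see Ck_normE and
   Ck_norm_regular. *)
Definition Ck_norm (R : realType) (n d k : nat) (V : set 'M[R]_(n, d))
    (f : 'M[R]_(n, d) -> R) : \bar R :=
  ereal_inf [set (sum_max_derivs k V F)%:E | F in Ck_extension k V f].

Lemma Ck_normE (R : realType) (n d k : nat) (V : set 'M[R]_(n, d))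
    (f F : 'M[R]_(n, d) -> R) :
  Ck_extension k V f F ->
  (forall (G : 'M[R]_(n, d) -> R) (alpha : mpoly.bmultinom (n * d) k.+1) x,
    Ck_extension k V f G -> V x ->
    multi_deriv alpha G x = multi_deriv alpha F x) ->
  Ck_norm k V f = (sum_max_derivs k V F)%:E.
Proof.
move=> FE Fdet; rewrite /Ck_norm (_ : image _ _ = [set (sum_max_derivs k V F)%:E]).
  exact: ereal_inf1.
apply/seteqP; split => [_ [G GE <-]|_ ->]; last by exists F.
congr (_%:E); apply: eq_bigr => a _; congr sup.
by apply/seteqP; split => _ [x Vx <-]; exists x; rewrite // (Fdet G).
Qed.

Lemma Ck_on_foldr (R : realType) (n d : nat) (U : set 'M[R]_(n, d))
    (alpha : 'I_(n * d) -> nat) (F : 'M[R]_(n, d) -> R)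
    (s : seq 'I_(n * d)) (k : nat) :
  Ck_on (k + \sum_(c <- s) alpha c)%N U F ->
  Ck_on k U (foldr (fun c g => iter (alpha c) (partial c) g) F s).
Proof.
elim: s k => [|c s IH] k /=; first by rewrite big_nil addn0.
rewrite big_cons addnA => /IH; elim: (alpha c) k => [|m IHm] k /=.
  by rewrite addn0.
by rewrite addnS -addSn => /IHm[_ /(_ c)[]].
Qed.

Lemma Ck_on_continuous (R : realType) (n d k : nat) (U : set 'M[R]_(n, d))
    (F : 'M[R]_(n, d) -> R) x : Ck_on k U F -> U x -> {for x, continuous F}.
Proof. by case: k => [|k] [+ _]; apply. Qed.

Lemma multi_deriv_continuous (R : realType) (n d k : nat)
    (U : set 'M[R]_(n, d)) (F : 'M[R]_(n, d) -> R)
    (alpha : mpoly.bmultinom (n * d) k.+1) x :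
  Ck_on k U F -> U x -> {for x, continuous (multi_deriv alpha F)}.
Proof.
move=> FU; apply: (@Ck_on_continuous _ _ _ (k - mpoly.mdeg alpha)).
apply: Ck_on_foldr; move: (mpoly.bmdeg alpha).
by rewrite mpoly.mdegE big_enum ltnS => /subnK->.
Qed.

Lemma eq_multi_deriv (R : realType) (n d : nat)
    (alpha : mpoly.multinom (n * d)) (W : set 'M[R]_(n, d))
    (F G : 'M[R]_(n, d) -> R) :
  open W -> (forall x, W x -> F x = G x) ->
  forall x, W x -> multi_deriv alpha F x = multi_deriv alpha G x.
Proof.
move=> Wo FG; rewrite /multi_deriv; elim: (enum _) => //= c s IH.
elim: (alpha c) => //= m IHm x Wx; rewrite /partial.
apply: near_eq_derive; near=> y; apply: IHm; near: y.
exact: open_nbhs_nbhs.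
Unshelve. all: by end_near. Qed.

Lemma Ck_norm_regular (R : realType) (n d k : nat) (V : set 'M[R]_(n, d))
    (f F : 'M[R]_(n, d) -> R) :
  V `<=` closure V° -> Ck_extension k V f F ->
  Ck_norm k V f = (sum_max_derivs k V F)%:E.
Proof.
move=> Vreg FE; apply: (Ck_normE FE) => G alpha x GE Vx.
case: FE => U [_ VU FU Ff]; case: GE => U' [_ VU' GU' Gf].
pose h := multi_deriv alpha G - multi_deriv alpha F.
have hc : {for x, continuous h}.
  apply: continuousB; first exact: multi_deriv_continuous GU' (VU' _ Vx).
  exact: multi_deriv_continuous FU (VU _ Vx).
apply/eqP; rewrite -subr_eq0; apply: contrapT => /negP h0.
have /(Vreg _ Vx)[y [Vy]] : nbhs x (h @^-1` [set r | r != 0]).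
  apply: hc; apply: open_nbhs_nbhs; split => //; exact: open_neq.
rewrite /h /= !fctE (@eq_multi_deriv _ _ _ _ V° _ F) ?subrr ?eqxx//.
  exact: open_interior.
by move=> z /interior_subset Vz; rewrite Gf// Ff.
Qed.

(* Main.v *)
(* Multiplying an extension of f by a C^k cutoff (built from powers of positive
   parts) gives a compactly supported C^k function G on the whole space with
   G = f on Omega^n.  For a polynomial K on the line put
     (T_c G)(x) = \int G(x with x_c replaced by s) K(x_c - s) ds.
   T_c G is polynomial in x_c, and T_c commutes with every partial derivative:
   with d/dx_c by integration by parts, G being compactly supported.  Hence with
   Landau kernels, which are approximate units for the uniform norm, T_c G tends
   to G together with all derivatives of order at most k.  Applying T_c for all
   coordinates c in turn yields a polynomial p, and one antisymmetrizes G - p.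
   Bounding the iterated partial derivatives in every order makes the estimate
   invariant under permutations without Schwarz's theorem. *)
Require Import Defs.
From mathcomp Require Import all_boot all_order all_algebra all_fingroup.
From mathcomp Require Import all_classical all_reals all_analysis.
From mathcomp Require mpoly.
Import (canonicals, coercions) mpoly.
From mathcomp Require Import ring lra.

Set Implicit Arguments.
Unset Strict Implicit.
Unset Printing Implicit Defensive.

Import Order.TTheory GRing.Theory Num.Theory.
Import numFieldNormedType.Exports.

Local Open Scope classical_set_scope.
Local Open Scope ring_scope.

(** * Coordinates and functions of class C^k *)

(** Let [B] bound the coordinates on [Omega^n], with G zero as soon as one coordinate exceeds [B] in
    absolute value. Integrating over [-(B+1), B+1] leaves a margin 1, which keeps the peak of the
    kernel inside the interval for every point of [Omega^n]. There the differences x_c - s lie in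
    [-2(B+1), 2(B+1)], which is therefore the interval on which the kernels are normalized. The
    obstacle to iterating is that T_c G, being polynomial in x_c, in general no longer vanishes for
    large x_c, while integration by parts in x_c needs this. But T_c alters x_c alone, so vanishing
    in the other coordinates survives, and each coordinate is treated exactly once. Off [Omega^n]
    the extension G need not be antisymmetric. Let P be the antisymmetrization of p. Since f is
    antisymmetric on [Omega^n], the antisymmetrization of G - p is a C^k extension of f - P. The
    norm being an infimum over extensions, it is enough to bound this one. *)

Lemma is_derive_line (R : realType) (V : normedModType R) (x v : V)
    (f : V -> R) df :
  is_derive x v f df <-> is_derive 0 (1 : R) (fun t => f (x + t *: v)) df.
Proof.
have E : (fun h : R => h^-1 *: (f (h *: v + x) - f x)) =
   (fun h : R => h^-1 *: (f (x + (h *: (1 : R) + 0) *: v) - f (x + 0 *: v))).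
  apply/funext => h; rewrite scale0r !addr0 (addrC (h *: v)).
  by rewrite -[h *: (1 : R)]/(h * 1) mulr1.
by split=> -[D1 D2]; split; move: D1 D2; rewrite /derivable /derive E.
Qed.

Lemma is_derive_line_at (R : realType) (V : normedModType R) (x v : V)
    (f : V -> R) df (t : R) :
  is_derive (x + t *: v) v f df -> is_derive t (1 : R) (fun t => f (x + t *:
    v)) df.
Proof.
move=> /is_derive_line fD; apply/is_derive_line; congr (is_derive _ _ _ _) : fD.
apply/funext => u; rewrite -[u *: (1 : R)]/(u * 1) mulr1.
by rewrite -addrA -scalerDl.
Qed.

(** The increment [h] may have either sign, as in a two-sided difference quotient; hence the
    intermediate point is located by its absolute value only. *)
Lemma mean_value_line (R : realType) (f f' : R -> R) (h : R) :
  (forall t : R, is_derive t (1 : R) f (f' t)) ->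
  exists2 u : R, `|u| <= `|h| & f h - f 0 = f' u * h.
Proof.
move=> fD; have fc : continuous f.
  move=> t; apply: differentiable_continuous.
  by apply/derivable1_diffP; case: (fD t).
have [h0|h0] := lerP 0 h.
- have [u] := @MVT_segment _ f f' 0 h h0 (fun t _ => fD t)
    (@continuous_subspaceT _ _ _ _ fc).
  rewrite in_itv subr0 => /andP[u0 uh] E; exists u => //.
  by rewrite !ger0_norm.
- have [u] := @MVT_segment _ f f' h 0 (ltW h0) (fun t _ => fD t)
    (@continuous_subspaceT _ _ _ _ fc).
  rewrite in_itv sub0r => /andP[uh u0] E; exists u.
    by rewrite !ler0_norm ?lerN2 // ltW.
  by rewrite -(opprB (f 0)) E mulrN opprK.
Qed.

Section Coordinates.
Context {R : realType} {n d : nat}.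
Implicit Types (c : 'I_(n * d)) (x y v : 'M[R]_(n, d)) (t : R).

Definition entry c x : R := mxvec x 0 c.

(** Replaces the coordinate [c] of [x] by [t]. Written as a translation along a coordinate vector,
    so that varying [t] is moving on a line in the direction of a partial derivative. *)
Definition upd c t x := x + (t - entry c x) *: coord_vec R c.

Lemma entryD c x y : entry c (x + y) = entry c x + entry c y.
Proof. by rewrite /entry linearD mxE. Qed.

Lemma entryZ c t x : entry c (t *: x) = t * entry c x.
Proof. by rewrite /entry linearZ mxE. Qed.

Lemma entry_coord_vec c c' : entry c' (coord_vec R c) = (c' == c)%:R.
Proof. by rewrite /entry /coord_vec vec_mxK mxE eqxx. Qed.

Lemma entry_inj x y : (forall c, entry c x = entry c y) -> x = y.
Proof.
move=> xy; apply: (can_inj mxvecK); apply/rowP => c; exact: xy.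
Qed.

Lemma entry_cts c : continuous (entry c).
Proof.
case/mxvec_indexP: c => i j.
rewrite (_ : entry _ = fun x : 'M[R]_(n, d) => x i j).
  exact: coord_continuous.
by apply/funext => x; rewrite /entry mxvecE.
Qed.

Lemma entry_upd c c' t x :
  entry c' (upd c t x) = if c' == c then t else entry c' x.
Proof.
rewrite /upd entryD entryZ entry_coord_vec; case: eqVneq => [->|_].
  by rewrite mulr1 addrC subrK.
by rewrite mulr0 addr0.
Qed.

Lemma upd_upd c t t' x : upd c t (upd c t' x) = upd c t x.
Proof. by apply: entry_inj => c'; rewrite !entry_upd; case: (c' == c). Qed.

Lemma upd_id c x : upd c (entry c x) x = x.
Proof. by rewrite /upd subrr scale0r addr0. Qed.

Lemma updC c c' t t' x : c != c' ->
  upd c t (upd c' t' x) = upd c' t' (upd c t x).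
Proof.
move=> cc'; apply: entry_inj => e; rewrite !entry_upd.
by case: (eqVneq e c) => // ->; rewrite (negbTE cc').
Qed.

Lemma upd_add_coord_vec c c' t h x : c' != c ->
  upd c t (x + h *: coord_vec R c') = upd c t x + h *: coord_vec R c'.
Proof.
move=> cc'; apply: entry_inj => e; rewrite !(entry_upd, entryD, entryZ).
rewrite entry_coord_vec; case: eqVneq => // ->.
by rewrite eq_sym (negbTE cc') mulr0 addr0.
Qed.

Lemma upd_addr c t h x :
  upd c t x + h *: coord_vec R c = upd c (t + h) x.
Proof. by rewrite /upd -addrA -scalerDl addrAC. Qed.

Lemma upd_add_same c t h x : upd c t (x + h *: coord_vec R c) = upd c t x.
Proof.
by rewrite -{1}(upd_id c x) upd_addr upd_upd.
Qed.

Lemma upd_cts2 c : continuous (fun p : 'M[R]_(n, d) * R => upd c p.2 p.1).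
Proof.
move=> p; apply: (@cvgD _ _ _ _ _ fst
  (fun p => (p.2 - entry c p.1) *: coord_vec R c)); first exact: cvg_fst.
apply: (@cvgZr_tmp _ _ _ _ _ (fun p => p.2 - entry c p.1)).
apply: (@cvgB _ _ _ _ _ snd (fun p => entry c p.1)); first exact: cvg_snd.
by apply: (@cvg_comp _ _ _ fst (entry c)); [exact: cvg_fst|exact: entry_cts].
Qed.

Lemma is_derive_entry c c' x :
  is_derive x (coord_vec R c') (entry c) (c == c')%:R.
Proof.
apply/is_derive_line.
rewrite (_ : (fun _ => _) = cst (entry c x) + (c == c')%:R \*: id).
  by apply: is_derive_eq; rewrite add0r [_ *: _]mulr1.
apply/funext => t /=; rewrite !fctE entryD entryZ entry_coord_vec.
by rewrite mulrC.
Qed.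

(** Only the derivative of [f] in the direction [v] is given, not a differential. Restricted to the
    line through [x], the composition obeys the chain rule of one variable. *)
Lemma is_derive_comp1 x v (h : R -> R) (f : 'M[R]_(n, d) -> R) a df :
  is_derive (f x) 1 h a -> is_derive x v f df ->
  is_derive x v (h \o f) (a * df).
Proof.
move=> hD /is_derive_line fD; apply/is_derive_line.
apply: (@is_derive1_comp _ h (fun t => f (x + t *: v))) => //.
by rewrite scale0r addr0.
Qed.

End Coordinates.

Section Ck.
Context {R : realType} {n d : nat}.
Implicit Types (c : 'I_(n * d)) (U W : set 'M[R]_(n, d))
  (F G : 'M[R]_(n, d) -> R).

Lemma Ck_onS k U F : Ck_on k.+1 U F -> Ck_on k U F.
Proof.
elim: k F => [|k IH] F [Fc FD]; split=> // c.
by have [FcD /IH] := FD c.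
Qed.

Lemma Ck_on_is_derive k U F x c : Ck_on k.+1 U F -> U x ->
  is_derive x (coord_vec R c) F (partial c F x).
Proof. by case=> _ /(_ c)[FD _] Ux; split=> //; exact: FD. Qed.

Lemma Ck_on_partial k U F c : Ck_on k.+1 U F -> Ck_on k U (partial c F).
Proof. by case=> _ /(_ c)[]. Qed.

Lemma near_eq_continuous F G (x : 'M[R]_(n, d)) :
  {near x, F =1 G} -> {for x, continuous F} -> {for x, continuous G}.
Proof.
move=> FG Fc; have E : F x = G x := nbhs_singleton FG.
rewrite /prop_for /continuous_at -E; apply: cvg_trans Fc; apply: (@near_eq_cvg
  _ _ (nbhs x)).
exact: filterS FG.
Qed.

Lemma eq_Ck_on k U F G : open U -> (forall x, U x -> F x = G x) ->
  Ck_on k U F -> Ck_on k U G.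
Proof.
move=> Uo; elim: k F G => [|k IH] F G FG [Fc FD].
  split=> // x Ux; apply: near_eq_continuous (Fc _ Ux).
  by near=> y; apply: FG; near: y; exact: open_nbhs_nbhs.
have nFG x : U x -> {near x, F =1 G}.
  by move=> Ux; near=> y; apply: FG; near: y; exact: open_nbhs_nbhs.
split=> [x Ux|c]; first exact: near_eq_continuous (nFG _ Ux) (Fc _ Ux).
have [Fd FP] := FD c; split=> [x Ux|].
  exact: near_eq_derivable (nFG _ Ux) (Fd _ Ux).
by apply: IH FP => x Ux; apply: near_eq_derive; exact: nFG.
Unshelve. all: by end_near. Qed.

(** [Ck_on] recurses on [partial c F] itself. Here the derivatives are supplied as explicit
    functions that need to agree with it on [U] only; since [U] is open, the agreement passes to all
    further derivatives. *)
Lemma Ck_on_intro k U F (G : 'I_(n * d) -> 'M[R]_(n, d) -> R) : open U ->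
  (forall x, U x -> {for x, continuous F}) ->
  (forall c x, U x -> is_derive x (coord_vec R c) F (G c x)) ->
  (forall c, Ck_on k U (G c)) -> Ck_on k.+1 U F.
Proof.
move=> Uo Fc FD GC; split=> // c; split=> [x Ux|].
  by have [] := FD c x Ux.
by apply: eq_Ck_on (GC c) => // x Ux; have [_ <-] := FD c x Ux.
Qed.

Lemma Ck_onU k U W F : Ck_on k U F -> Ck_on k W F -> Ck_on k (U `|` W) F.
Proof.
elim: k F => [|k IH] F [Fc FD] [Fc' FD']; split=> //.
- by move=> x [/Fc|/Fc'].
- by move=> x [/Fc|/Fc'].
- move=> c; have [? ?] := FD c; have [? ?] := FD' c.
  by split=> [x []|]; auto.
Qed.

Lemma Ck_on_cst k U (a : R) : open U -> Ck_on k U (cst a).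
Proof.
move=> Uo; elim: k a => [|k IH] a; first by split=> // x _; exact:
  cst_continuous.
apply: (@Ck_on_intro _ _ _ (fun _ => cst 0)) => //.
by move=> x _; exact: cst_continuous.
Qed.

Lemma Ck_on_entry k U c : open U -> Ck_on k U (entry c).
Proof.
case: k => [|k] Uo; first by split=> // x _; exact: entry_cts.
apply: (@Ck_on_intro _ _ _ (fun c' => cst (c == c')%:R)) => //.
- by move=> x _; exact: entry_cts.
- by move=> c' x _; exact: is_derive_entry.
- by move=> c'; exact: Ck_on_cst.
Qed.

Lemma Ck_onD k U F G : open U -> Ck_on k U F -> Ck_on k U G ->
  Ck_on k U (F + G).
Proof.
move=> Uo; elim: k F G => [|k IH] F G FC GC.
  split=> // x Ux; apply: continuousD;
    [exact: Ck_on_continuous FC Ux|exact: Ck_on_continuous GC Ux].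
apply: (@Ck_on_intro _ _ _ (fun c => partial c F + partial c G)) => //.
- by move=> x Ux; apply: continuousD;
    [exact: Ck_on_continuous FC Ux|exact: Ck_on_continuous GC Ux].
- move=> c x Ux; apply: is_deriveD;
    [exact: Ck_on_is_derive FC Ux|exact: Ck_on_is_derive GC Ux].
- by move=> c; apply: IH; exact: Ck_on_partial.
Qed.

Lemma Ck_onM k U F G : open U -> Ck_on k U F -> Ck_on k U G ->
  Ck_on k U (F * G).
Proof.
move=> Uo; elim: k F G => [|k IH] F G FC GC.
  split=> // x Ux; apply: continuousM;
    [exact: Ck_on_continuous FC Ux|exact: Ck_on_continuous GC Ux].
apply: (@Ck_on_intro _ _ _ (fun c => F * partial c G + G * partial c F)) => //.
- by move=> x Ux; apply: continuousM;
    [exact: Ck_on_continuous FC Ux|exact: Ck_on_continuous GC Ux].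
- move=> c x Ux; apply: is_deriveM;
    [exact: Ck_on_is_derive FC Ux|exact: Ck_on_is_derive GC Ux].
- move=> c; apply: Ck_onD => //; apply: IH;
    by [exact: Ck_onS|exact: Ck_on_partial].
Qed.

Lemma Ck_on_sum k U (I : Type) (r : seq I) (F : I -> 'M[R]_(n, d) -> R) :
  open U -> (forall i, Ck_on k U (F i)) ->
  Ck_on k U (fun x => \sum_(i <- r) F i x).
Proof.
move=> Uo FC; rewrite -fct_sumE.
elim/big_ind: _ => //; [exact: Ck_on_cst|move=> *; exact: Ck_onD].
Qed.

Lemma Ck_on_prod k U (I : Type) (r : seq I) (F : I -> 'M[R]_(n, d) -> R) :
  open U -> (forall i, Ck_on k U (F i)) ->
  Ck_on k U (fun x => \prod_(i <- r) F i x).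
Proof.
move=> Uo FC; rewrite -fct_prodE.
elim/big_ind: _ => //; [exact: Ck_on_cst|move=> *; exact: Ck_onM].
Qed.

End Ck.

(** * Integrals over a symmetric interval *)

Lemma section_continuous (T U W : topologicalType) (H : T * U -> W) (x : T) :
  continuous H -> continuous (fun s => H (x, s)).
Proof.
move=> Hc s; apply: (@continuous_comp _ _ _ (fun s => (x, s)) H); last exact:
  Hc.
move=> B [[P Q] /= [xP sQ] PQ]; apply: filterS sQ => s' Qs'.
by apply: PQ; split=> //; exact: nbhs_singleton.
Qed.

Section SymmetricIntegral.
Context {R : realType} (A : R).
Context (A0 : 0 < A).
Implicit Types (g : R -> R).

Definition symint g : R := \int[lebesgue_measure]_(s in `[- A, A]) g s.

Let AA : - A < A. Proof. by rewrite gtrN. Qed.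

Lemma symint_integrable g : continuous g ->
  lebesgue_measure.-integrable `[- A, A] (EFin \o g).
Proof.
move=> gc; apply: continuous_compact_integrable.
  exact: segment_compact.
exact: continuous_subspaceT.
Qed.

Lemma symintD f g : continuous f -> continuous g ->
  symint (fun s => f s + g s) = symint f + symint g.
Proof. by move=> fc gc; apply: RintegralD => //; exact: symint_integrable. Qed.

Lemma symintZ a g : continuous g -> symint (fun s => a * g s) = a * symint g.
Proof. by move=> gc; apply: RintegralZl => //; exact: symint_integrable. Qed.

Lemma symintB f g : continuous f -> continuous g ->
  symint (fun s => f s - g s) = symint f - symint g.
Proof. by move=> fc gc; apply: RintegralB => //; exact: symint_integrable. Qed.

Lemma le_symint f g : continuous f -> continuous g ->
  (forall s, - A <= s <= A -> f s <= g s) -> symint f <= symint g.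
Proof.
by move=> fc gc fg; apply: le_Rintegral => //; exact: symint_integrable.
Qed.

Lemma symint_FTC (F g : R -> R) : continuous g ->
  (forall s : R, is_derive s (1 : R) F (g s)) -> symint g = F A - F (- A).
Proof.
move=> gc FD; have Fc : continuous F.
  move=> t; apply: differentiable_continuous.
  by apply/derivable1_diffP; case: (FD t).
rewrite /symint /Rintegral (@continuous_FTC2 _ _ F) //.
- exact: continuous_subspaceT.
- split; first by move=> s _; case: (FD s).
    by apply: cvg_at_right_filter; exact: Fc.
  by apply: cvg_at_left_filter; exact: Fc.
- by move=> s _; rewrite derive1E; case: (FD s).
Qed.

Lemma symint_cst a : symint (cst a) = a * (A *+ 2).
Proof.
have aD (s : R) : is_derive s (1 : R) (a \*: id) (cst a s).
  by apply: is_derive_eq; rewrite [_ *: _]mulr1.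
rewrite (symint_FTC _ aD); last exact: cst_continuous.
by rewrite -[(_ \*: _) A]/(a * A) -[(_ \*: _) (- A)]/(a * - A); ring.
Qed.

Lemma symint_norm_le g a : continuous g ->
  (forall s, - A <= s <= A -> `|g s| <= a) -> `|symint g| <= a * (A *+ 2).
Proof.
move=> gc ga; rewrite ler_norml; apply/andP; split.
  rewrite -mulNr -symint_cst; apply: le_symint => // [|s /ga].
    exact: cst_continuous.
  by rewrite ler_norml => /andP[].
rewrite -symint_cst; apply: le_symint => // [|s /ga].
  exact: cst_continuous.
by rewrite ler_norml => /andP[].
Qed.

(** A tube lemma: compactness of the segment makes continuity in the parameter uniform in [s], for a
    parameter in any topological space. *)
Lemma near_param_segment (T : topologicalType) (H : T * R -> R) (x : T) (e : R)
  :
  continuous H -> 0 < e ->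
  \forall y \near x, forall s, - A <= s <= A -> `|H (y, s) - H (x, s)| <= e.
Proof.
move=> Hc e0.
pose P (y : T) (s : R) := `|H (y, s) - H (x, s)| <= e.
suff : \forall y \near x, `[- A, A] `<=` P y.
  by apply: filterS => y yP s sA; apply: yP; rewrite /= in_itv.
apply: (compact_near_coveringP _).1 => [|s0 _]; first exact: segment_compact.
have e20 : 0 < e / 2 by rewrite divr_gt0.
have [[U W] /= [xU sW] UW] : \forall p \near (x, s0), `|H (x, s0) - H p| < e /
  2.
  by have /cvgrPdist_lt /(_ _ e20) := Hc (x, s0).
exists (W, U) => //= -[s y] [/= Ws Uy]; rewrite /P.
have h1 := UW (y, s) (conj Uy Ws); have h2 := UW (x, s) (conj (nbhs_singleton
  xU) Ws).
rewrite -(subrKA (H (x, s0))) (le_trans (ler_normD _ _)) // (splitr e) lerD //.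
  by rewrite distrC ltW.
exact: ltW.
Qed.

Lemma symint_param_continuous (T : topologicalType) (H : T * R -> R) :
  continuous H -> continuous (fun x => symint (fun s => H (x, s))).
Proof.
move=> Hc x; have Hx y : continuous (fun s => H (y, s)) := @section_continuous
  _ _ _ _ y Hc.
apply/cvgrPdist_le => e e0.
have e'0 : 0 < e / (A *+ 2) by rewrite divr_gt0 // mulrn_wgt0.
apply: filterS (@near_param_segment _ _ x _ Hc e'0) => y yP.
rewrite distrC -symintB //.
have := @symint_norm_le (fun s => H (y, s) - H (x, s)) (e / (A *+ 2)).
rewrite divfK; last by rewrite gt_eqF // mulrn_wgt0.
by apply=> // s; apply: continuousB; exact: Hx.
Qed.

(** By the mean value theorem the difference quotient at [s] is [h'] at a parameter close to [t],
    and [near_param_segment] makes this close to [h' (t, s)] uniformly in [s]. No dominated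
    convergence is involved. *)
Lemma symint_param_derive (h h' : R * R -> R) (t : R) :
  continuous h -> continuous h' ->
  (forall (t s : R), is_derive t (1 : R) (fun t => h (t, s)) (h' (t, s))) ->
  is_derive t (1 : R) (fun t => symint (fun s => h (t, s)))
    (symint (fun s => h' (t, s))).
Proof.
move=> hc h'c hD.
have hx y : continuous (fun s => h (y, s)) := @section_continuous _ _ _ _ y hc.
have h'x y : continuous (fun s => h' (y, s)) := @section_continuous _ _ _ _ y
  h'c.
have A20 : 0 < A *+ 2 by rewrite mulrn_wgt0.
suff L : (fun u : R => u^-1 *: (symint (fun s => h (u *: (1 : R) + t, s)) -
    symint (fun s => h (t, s)))) @ 0^' --> symint (fun s => h' (t, s)).
  by split; [apply: cvgP L | apply: cvg_lim L].
apply/cvgrPdist_le => e e0.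
have e'0 : 0 < e / (A *+ 2) by rewrite divr_gt0.
have [r /= r0 rP] := (nbhs_ballP _ _).1 (@near_param_segment _ _ t _ h'c e'0).
exists r => //= u; rewrite /= sub0r normrN => ur u0.
rewrite -[_ *: _]/(u^-1 * _) -[u *: (1 : R)]/(u * 1) mulr1.
(* The point [v] depends on [s] in an uncontrolled way, but it only enters a pointwise bound and is
   never integrated. *)
have mv s : exists2 v : R, `|v| <= `|u| &
    h (u + t, s) - h (t, s) = h' (t + v, s) * u.
  have [|v vu E] := @mean_value_line _ (fun v => h (t + v * 1, s))
      (fun v => h' (t + v * 1, s)) u.
    by move=> w; apply: (@is_derive_line_at _ _ t (1 : R) (fun t => h (t, s))).
  by exists v => //; rewrite (addrC u); move: E; rewrite !mulr1 addr0.
have dc : continuous (fun s => h (u + t, s) - h (t, s)).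
  by move=> s; apply: continuousB; exact: hx.
have dZc : continuous (fun s => u^-1 * (h (u + t, s) - h (t, s))).
  move=> s; apply: (@continuousM _ _ (cst u^-1)
    (fun s => h (u + t, s) - h (t, s))); first exact: cst_continuous.
  exact: dc.
rewrite -symintB // -symintZ // -symintB //.
rewrite -[e](divfK (lt0r_neq0 A20)); apply: symint_norm_le => [s|s sA].
  apply: (@continuousB _ _ _ (fun s => h' (t, s))
    (fun s => u^-1 * (h (u + t, s) - h (t, s)))); last exact: dZc.
  exact: h'x.
have [v vu ->] := mv s; rewrite mulrC mulfK // distrC; apply: rP => //.
by rewrite /ball /= opprD addNKr normrN (le_lt_trans vu).
Qed.

End SymmetricIntegral.

(** * Convolution with a polynomial in one coordinate *)

Section PolynomialConvolution.
Context {R : realType} {n d : nat} (A : R).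
Context (A0 : 0 < A).
Implicit Types (c : 'I_(n * d)) (x y : 'M[R]_(n, d)) (K : {poly R})
  (G : 'M[R]_(n, d) -> R).

(** The operator T_c, with the integral restricted to [-A, A]; nothing is lost when [G] vanishes for
    [|entry c x| >= A]. *)
Definition pconv c K G x :=
  symint A (fun s => G (upd c s x) * K.[entry c x - s]).

Lemma cts_horner_sub (T : topologicalType) (f g : T -> R) K :
  continuous f -> continuous g -> continuous (fun p => K.[f p - g p]).
Proof.
move=> fc gc p; apply: (@continuous_comp _ _ _ (fun p => f p - g p) (horner K)).
  by apply: continuousB; [exact: fc|exact: gc].
exact: continuous_horner.
Qed.

Lemma cts_sub (T : topologicalType) (f g : T -> R) :
  continuous f -> continuous g -> continuous (fun p => f p - g p).
Proof. by move=> fc gc p; apply: continuousB; [exact: fc|exact: gc]. Qed.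

Lemma cts_mul (T : topologicalType) (f g : T -> R) :
  continuous f -> continuous g -> continuous (fun p => f p * g p).
Proof. by move=> fc gc p; apply: continuousM; [exact: fc|exact: gc]. Qed.

Lemma cts_fst (T U : topologicalType) : continuous (@fst T U).
Proof. by move=> p; exact: cvg_fst. Qed.

Lemma cts_snd (T U : topologicalType) : continuous (@snd T U).
Proof. by move=> p; exact: cvg_snd. Qed.

Lemma cts_comp (T U W : topologicalType) (f : T -> U) (g : U -> W) :
  continuous f -> continuous g -> continuous (fun t => g (f t)).
Proof.
move=> fc gc x; apply: (@continuous_comp _ _ _ f g); [exact: fc|exact: gc].
Qed.

Lemma upd_continuous_l c x : continuous (fun s => upd c s x).
Proof.
apply: (@section_continuous 'M[R]_(n, d) R 'M[R]_(n, d) (fun p : 'M[R]_(n, d) *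
  R => upd c p.2 p.1)
  x); exact: (@upd_cts2 R n d c).
Qed.

Lemma line_continuous c c' x :
  continuous (fun p : R * R => upd c p.2 x + p.1 *: coord_vec R c').
Proof.
move=> p; apply: (@continuousD _ _ _ (fun p : R * R => upd c p.2 x)
  (fun p => p.1 *: coord_vec R c')).
  apply: (@continuous_comp _ _ _ snd (fun s => upd c s x)).
    exact: cts_snd.
  exact: upd_continuous_l.
apply: (@continuousZr_tmp _ _ _ fst); exact: cts_fst.
Qed.

Lemma pconv_continuous c K G : continuous G -> continuous (pconv c K G).
Proof.
move=> Gc; apply: (@symint_param_continuous _ _ A0 _
  (fun p : 'M[R]_(n, d) * R => G (upd c p.2 p.1) * K.[entry c p.1 - p.2])).
apply: cts_mul; first exact: (cts_comp (@upd_cts2 R n d c) Gc).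
apply: cts_horner_sub; last exact: cts_snd.
exact: (cts_comp (@cts_fst 'M[R]_(n, d) R) (@entry_cts R n d c)).
Qed.

Lemma is_derive_horner_sub K (a s : R) :
  is_derive s (1 : R) (fun s => K.[a - s]) (- K^`().[a - s]).
Proof.
have := is_derive_poly K (a - s) => D.
have E : is_derive s (1 : R) (fun s => a - s) (- 1).
  by apply: is_derive_eq; rewrite add0r mul1r.
have := @is_derive1_comp _ (horner K) (fun s => a - s) s _ _ D E.
by rewrite mulrN1.
Qed.

Lemma is_derive_upd c G (G' : 'M[R]_(n, d) -> R) x (s : R) :
  (forall y, is_derive y (coord_vec R c) G (G' y)) ->
  is_derive s (1 : R) (fun s => G (upd c s x)) (G' (upd c s x)).
Proof.
move=> GD; rewrite (_ : (fun _ => _) =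
    fun s => G (upd c 0 x + s *: coord_vec R c)).
  have := @is_derive_line_at _ _ (upd c 0 x) (coord_vec R c) G _ s (GD _).
  by rewrite upd_addr add0r.
by apply/funext => t; rewrite upd_addr add0r.
Qed.

Lemma cts_id (T : topologicalType) : continuous (fun t : T => t).
Proof. by move=> x B. Qed.

(** Both sides carry the same sign: the minus sign of integration by parts cancels the one from
    differentiating [K.[a - s]] in [s]. The boundary terms are the values of [G] at the two ends,
    which are zero. *)
Lemma symint_by_parts c K G (G' : 'M[R]_(n, d) -> R) x a :
  continuous G -> continuous G' ->
  (forall y, is_derive y (coord_vec R c) G (G' y)) ->
  G (upd c A x) = 0 -> G (upd c (- A) x) = 0 ->
  symint A (fun s => G (upd c s x) * K^`().[a - s]) =
  symint A (fun s => G' (upd c s x) * K.[a - s]).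
Proof.
move=> Gc G'c GD GA GNA; apply/eqP; rewrite eq_sym -subr_eq0 -symintB //; last
  2 first.
- apply: cts_mul; first exact: (cts_comp (@upd_continuous_l c x) G'c).
  exact: (cts_horner_sub (@cst_continuous R R a) (@cts_id R)).
- apply: cts_mul; first exact: (cts_comp (@upd_continuous_l c x) Gc).
  exact: (cts_horner_sub (@cst_continuous R R a) (@cts_id R)).
have D (s : R) : is_derive s (1 : R) (fun s => G (upd c s x) * K.[a - s])
    (G' (upd c s x) * K.[a - s] - G (upd c s x) * K^`().[a - s]).
  have := @is_deriveM _ _ _ _ s (1 : R) _ _ (is_derive_upd x s GD)
    (is_derive_horner_sub K a s).
  by congr (is_derive _ _ _ _); rewrite -![_ *: _]/(_ * _); ring.
rewrite (symint_FTC A0 _ D); first by rewrite GA GNA !mul0r subrr.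
apply: cts_sub; apply: cts_mul.
- exact: (cts_comp (@upd_continuous_l c x) G'c).
- exact: (cts_horner_sub (@cst_continuous R R a) (@cts_id R)).
- exact: (cts_comp (@upd_continuous_l c x) Gc).
- exact: (cts_horner_sub (@cst_continuous R R a) (@cts_id R)).
Qed.

(** In the direction [c] the update erases the dependence of [G] on [x], so the derivative falls on
    [K] and is moved to [G] by parts. In any other direction the kernel is constant and the
    derivative falls on [G] directly. *)
Lemma pconv_derive c c' K G (G' : 'M[R]_(n, d) -> R) x :
  continuous G -> continuous G' ->
  (forall y, is_derive y (coord_vec R c') G (G' y)) ->
  (forall y, A <= `|entry c y| -> G y = 0) ->
  is_derive x (coord_vec R c') (pconv c K G) (pconv c K G' x).
Proof.
move=> Gc G'c GD GA; apply/is_derive_line.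
have [E|cc'] := eqVneq c c'.
  subst c'.
  rewrite /pconv -(@symint_by_parts _ _ G) //; last 2 first.
  - by apply: GA; rewrite entry_upd eqxx ger0_norm // ltW.
  - by apply: GA; rewrite entry_upd eqxx normrN ger0_norm // ltW.
  rewrite (_ : (fun _ => _) = fun t => symint A (fun s =>
      G (upd c s x) * K.[(entry c x + t) - s])); last first.
    apply/funext => t; congr symint; apply/funext => s.
    by rewrite upd_add_same entryD entryZ entry_coord_vec eqxx mulr1.
  have := @symint_param_derive _ _ A0
    (fun p => G (upd c p.2 x) * K.[(entry c x + p.1) - p.2])
    (fun p => G (upd c p.2 x) * K^`().[(entry c x + p.1) - p.2]) 0.
  rewrite /= addr0; apply.
  - apply: cts_mul.
      exact: (cts_comp (cts_comp (@cts_snd R R) (@upd_continuous_l c x)) Gc).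
    apply: cts_horner_sub; last exact: cts_snd.
    move=> p; apply: (@continuousD _ _ _ (cst (entry c x)) fst).
      exact: cst_continuous.
    exact: cts_fst.
  - apply: cts_mul.
      exact: (cts_comp (cts_comp (@cts_snd R R) (@upd_continuous_l c x)) Gc).
    apply: cts_horner_sub; last exact: cts_snd.
    move=> p; apply: (@continuousD _ _ _ (cst (entry c x)) fst).
      exact: cst_continuous.
    exact: cts_fst.
  - move=> t s.
    have D : is_derive t (1 : R) (fun t => K.[(entry c x + t) - s])
        K^`().[(entry c x + t) - s].
      have D0 := is_derive_poly K (entry c x + t - s).
      have E : is_derive t (1 : R) (fun t => entry c x + t - s) 1.
        by apply: is_derive_eq; rewrite add0r subr0.
      have := @is_derive1_comp _ (horner K) _ t _ _ D0 E.
      by rewrite mulr1.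
    exact: (is_deriveZ (G (upd c s x)) D).
rewrite (_ : (fun _ => _) = fun t => symint A (fun s =>
    G (upd c s x + t *: coord_vec R c') * K.[entry c x - s])); last first.
  apply/funext => t; congr symint; apply/funext => s.
  rewrite upd_add_coord_vec 1?eq_sym // entryD entryZ entry_coord_vec.
  by rewrite (negbTE cc') mulr0 addr0.
have := @symint_param_derive _ _ A0
  (fun p => G (upd c p.2 x + p.1 *: coord_vec R c') * K.[entry c x - p.2])
  (fun p => G' (upd c p.2 x + p.1 *: coord_vec R c') * K.[entry c x - p.2]) 0.
rewrite /= (_ : (fun s => G' _ * _) = fun s => G' (upd c s x) * K.[entry c x -
  s]).
  apply.
  - apply: cts_mul; first exact: (cts_comp (@line_continuous c c' x) Gc).
    exact: (cts_horner_sub (@cst_continuous (R * R)%type R _) (@cts_snd R R)).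
  - apply: cts_mul; first exact: (cts_comp (@line_continuous c c' x) G'c).
    exact: (cts_horner_sub (@cst_continuous (R * R)%type R _) (@cts_snd R R)).
  - move=> t s; rewrite mulrC (_ : (fun _ => _) = fun t => K.[entry c x - s] *
        G (upd c s x + t *: coord_vec R c')); last first.
      by apply/funext => u; rewrite mulrC.
    exact: (is_deriveZ K.[entry c x - s] (@is_derive_line_at _ _ (upd c s x)
      (coord_vec R c') G _ t (GD _))).
by apply/funext => s; rewrite scale0r addr0.
Qed.

End PolynomialConvolution.

(** * Functions that are polynomial in some of the coordinates *)

Section PolynomialInSomeCoordinates.
Context {R : realType} {n d : nat}.
Implicit Types (c : 'I_(n * d)) (x y : 'M[R]_(n, d)) (K : {poly R})
  (g G : 'M[R]_(n, d) -> R) (S : seq 'I_(n * d)).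

(** Polynomials in the coordinates of [S] whose coefficients are continuous functions of the others:
    all continuous functions for empty [S], the polynomial functions when [S] contains every
    coordinate. The inductive form avoids carrying degrees and families of coefficients. *)
Inductive poly_in S : ('M[R]_(n, d) -> R) -> Prop :=
| poly_in_base g : continuous g ->
    (forall c t x, c \in S -> g (upd c t x) = g x) -> poly_in S g
| poly_in_add f g : poly_in S f -> poly_in S g ->
    poly_in S (fun x => f x + g x)
| poly_in_mul_entry c g : poly_in S g -> poly_in S (fun x => entry c x * g x).

Lemma poly_in_continuous S g : poly_in S g -> continuous g.
Proof.
elim=> [//|f h _ fc _ hc|c h _ hc].
  by move=> x; apply: continuousD; [exact: fc|exact: hc].
exact: (cts_mul (@entry_cts _ _ _ c) hc).
Qed.

Lemma poly_in_sum S m (F : nat -> 'M[R]_(n, d) -> R) :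
  (forall i, poly_in S (F i)) -> poly_in S (fun x => \sum_(i < m) F i x).
Proof.
move=> FS; elim: m => [|m IH].
  apply: poly_in_base => [|c t x _]; last by rewrite !big_ord0.
  rewrite (_ : (fun _ => _) = cst 0); first exact: cst_continuous.
  by apply/funext => y; rewrite big_ord0.
rewrite (_ : (fun _ => _) = fun x => \sum_(i < m) F i x + F m x).
  exact: poly_in_add.
by apply/funext => x; rewrite big_ord_recr.
Qed.

Lemma poly_in_mul_exp S c g i :
  poly_in S g -> poly_in S (fun x => entry c x ^+ i * g x).
Proof.
move=> gS; elim: i => [|i IH].
  by rewrite (_ : (fun _ => _) = g) //; apply/funext => x; rewrite mul1r.
rewrite (_ : (fun _ => _) = fun x => entry c x * (entry c x ^+ i * g x)).
  exact: poly_in_mul_entry.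
by apply/funext => x; rewrite exprS mulrA.
Qed.

Section Integral.
Context (A : R).
Context (A0 : 0 < A).

(** With suitable weights [q], these are the coefficients of the powers of [entry c x] in
    [pconv]. *)
Definition moment c (q : R -> R) g x := symint A (fun s => g (upd c s x) * q s).

Lemma moment_continuous c q g : continuous q -> continuous g ->
  continuous (moment c q g).
Proof.
move=> qc gc; apply: (@symint_param_continuous _ _ A0 _
  (fun p : 'M[R]_(n, d) * R => g (upd c p.2 p.1) * q p.2)).
apply: cts_mul; first exact: (cts_comp (@upd_cts2 R n d c) gc).
exact: (cts_comp (@cts_snd 'M[R]_(n, d) R) qc).
Qed.

(** Induction on [poly_in] for all weights [q] at once: a factor [entry c] becomes the integration
    variable and is absorbed into the weight, while a factor [entry c'] with another coordinate
    comes out of the integral. *)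
Lemma poly_in_moment S c q g : continuous q -> poly_in S g ->
  poly_in (c :: S) (moment c q g).
Proof.
move=> qc gS; elim: gS q qc => [{}g gc gS|f h fS IHf hS IHh|c' h hS IHh] q qc.
- apply: poly_in_base; first exact: moment_continuous.
  move=> c' t x; rewrite inE /moment => c'S; congr symint; apply/funext => s.
  have [->|/negPf cc'] := eqVneq c' c; first by rewrite upd_upd.
  move: c'S; rewrite cc' /= => c'S.
  by rewrite updC 1?eq_sym ?cc' // gS.
- rewrite (_ : moment _ _ _ = fun x => moment c q f x + moment c q h x).
    by apply: poly_in_add; [exact: IHf|exact: IHh].
  apply/funext => x; rewrite /moment -symintD.
  + by congr symint; apply/funext => s; rewrite mulrDl.
  + apply: cts_mul => //.
    exact: (cts_comp (@upd_continuous_l _ _ _ c x) (poly_in_continuous fS)).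
  + apply: cts_mul => //.
    exact: (cts_comp (@upd_continuous_l _ _ _ c x) (poly_in_continuous hS)).
- have [->|cc'] := eqVneq c' c.
    rewrite (_ : moment _ _ _ = moment c (fun s => s * q s) h).
      by apply: IHh; apply: cts_mul => //; exact: cts_id.
    apply/funext => x; congr symint; apply/funext => s.
    by rewrite entry_upd eqxx; ring.
  rewrite (_ : moment _ _ _ = fun x => entry c' x * moment c q h x).
    by apply: poly_in_mul_entry; exact: IHh.
  apply/funext => x; rewrite /moment -symintZ; last first.
    apply: cts_mul => //.
    exact: (cts_comp (@upd_continuous_l _ _ _ c x) (poly_in_continuous hS)).
  by congr symint; apply/funext => s; rewrite entry_upd (negPf cc') mulrA.
Qed.

Lemma symint_sum m (F : nat -> R -> R) : (forall i, continuous (F i)) ->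
  symint A (fun s => \sum_(i < m) F i s) = \sum_(i < m) symint A (F i).
Proof.
move=> Fc; have sumc k : continuous (fun s => \sum_(i < k) F i s).
  elim: k => [|k IH].
    rewrite (_ : (fun _ => _) = cst 0); first exact: cst_continuous.
    by apply/funext => s; rewrite big_ord0.
  rewrite (_ : (fun _ => _) = fun s => \sum_(i < k) F i s + F k s).
    by move=> s; apply: continuousD; [exact: IH|exact: Fc].
  by apply/funext => s; rewrite big_ord_recr.
elim: m => [|m IH].
  rewrite big_ord0 (_ : (fun _ => _) = cst 0).
    by rewrite symint_cst // mul0r.
  by apply/funext => s; rewrite big_ord0.
rewrite big_ord_recr /= -IH -symintD //.
by congr symint; apply/funext => s; rewrite big_ord_recr.
Qed.

(* Taylor expansion of [K.[entry c x - s]] in powers of [entry c x]. *)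
Lemma pconv_moments c K g x : continuous g ->
  pconv A c K g x = \sum_(i < size K)
    entry c x ^+ i * moment c (fun s => K^`N(i).[- s]) g x.
Proof.
move=> gc; have qc i : continuous (fun s : R => K^`N(i).[- s]).
  move=> s; apply: (@continuous_comp _ _ _ -%R (horner K^`N(i))).
    exact: opp_continuous.
  exact: continuous_horner.
have gqc i : continuous (fun s => g (upd c s x) * K^`N(i).[- s]).
  apply: cts_mul => //.
  exact: (cts_comp (@upd_continuous_l _ _ _ c x) gc).
rewrite /pconv (_ : (fun _ => _) = fun s => \sum_(i < size K)
    (entry c x ^+ i * (g (upd c s x) * K^`N(i).[- s]))).
  rewrite (@symint_sum _ (fun i s => entry c x ^+ i * (g (upd c s x) *
    K^`N(i).[- s]))).
    by apply: eq_bigr => i _; rewrite symintZ.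
  by move=> i; apply: cts_mul => //; exact: cst_continuous.
apply/funext => s; rewrite addrC nderiv_taylor; last exact: mulrC.
rewrite mulr_sumr; apply: eq_bigr => i _; ring.
Qed.

Lemma poly_in_pconv S c K g : poly_in S g -> poly_in (c :: S) (pconv A c K g).
Proof.
move=> gS; have gc := poly_in_continuous gS.
rewrite (_ : pconv _ _ _ _ = fun x => \sum_(i < size K)
    entry c x ^+ i * moment c (fun s => K^`N(i).[- s]) g x); last first.
  by apply/funext => x; exact: pconv_moments.
apply: (@poly_in_sum _ _ (fun i x =>
  entry c x ^+ i * moment c (fun s => K^`N(i).[- s]) g x)) => i.
apply: poly_in_mul_exp; apply: poly_in_moment => // s.
apply: (@continuous_comp _ _ _ -%R (horner K^`N(i))).
  exact: opp_continuous.
exact: continuous_horner.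
Qed.

End Integral.

Lemma poly_in_all S g : (forall c, c \in S) -> poly_in S g ->
  exists p : mpoly.mpoly (n * d) R, g = poly_fun p.
Proof.
move=> allS; elim=> [{}g _ gS|f h _ [p ->] _ [q ->]|c h _ [p ->]].
- exists (mpoly.mpolyC (n * d) (g 0)); apply/funext => x.
  rewrite /poly_fun mpoly.mevalC.
  (* Overwriting the coordinates by 0 one at a time never changes [g] and ends at the zero matrix,
     so [g] is constant. *)
  pose y := foldr (fun c z => upd c 0 z) x (enum 'I_(n * d)).
  have -> : g x = g y.
    by rewrite /y; elim: (enum _) => //= c s ->; rewrite gS.
  congr g; apply: entry_inj => c; rewrite /y.
  have : c \in enum 'I_(n * d) by rewrite mem_enum.
  have -> : entry c 0 = 0 :> R by rewrite /entry linear0 mxE.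
  elim: (enum _) => //= e s IH; rewrite inE entry_upd.
  by case: eqVneq.
- exists (p + q); apply/funext => x; by rewrite /poly_fun mpoly.mevalD.
- exists (mpoly.mpolyX _ (mpoly.mnm1 c) * p); apply/funext => x.
  by rewrite /poly_fun mpoly.mevalM mpoly.mevalXU.
Qed.

End PolynomialInSomeCoordinates.

(** * Landau kernels *)

(** An antiderivative expresses the mass of a polynomial kernel on an interval as a difference of
    two values, so that normalization and tails can be estimated by the mean value theorem. *)
Lemma ex_antideriv (R : realType) (p : {poly R}) : exists q, q^`() = p.
Proof.
exists (\poly_(i < (size p).+1) (p`_i.-1 / i%:R)); apply/polyP => i.
rewrite coef_deriv coef_poly ltnS; case: ltnP => ip /=.
  by rewrite -(mulr_natr (_ / _)) divfK // pnatr_eq0.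
by rewrite mul0rn nth_default.
Qed.

Lemma horner_mean_value (R : realType) (p : {poly R}) (a b : R) : a <= b ->
  exists2 u, a <= u <= b & p.[b] - p.[a] = p^`().[u] * (b - a).
Proof.
move=> ab; have [u] := @MVT_segment _ (horner p) (horner p^`()) a b ab
  (fun x _ => is_derive_poly p x)
  (@continuous_subspaceT _ _ _ _ (@continuous_horner _ p)).
by rewrite in_itv /= => ? ?; exists u.
Qed.

(* The kernels are the normalised powers of [1 - (u / L) ^ 2] (Landau). *)
Lemma landau_kernels (R : realType) (L : R) : 0 < L ->
  exists K Phi : nat -> {poly R}, [/\ forall m, (Phi m)^`() = K m,
    forall m, (Phi m).[L] - (Phi m).[- L] = 1,
    forall m (u : R), `|u| <= L -> 0 <= (K m).[u] &
    forall delta eta : R, 0 < delta -> 0 < eta ->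
      \forall m \near \oo, forall u : R, delta <= `|u| <= L -> (K m).[u] <=
        eta].
Proof.
move=> L0; pose p : {poly R} := 1%:P - (L ^- 2) *: 'X^2.
have pE u : p.[u] = 1 - (u / L) ^+ 2.
  by rewrite /p hornerD hornerN hornerZ hornerXn hornerC expr_div_n mulrC.
have sqr_le (u a : R) : 0 <= a -> `|u| <= a -> (u / L) ^+ 2 <= (a / L) ^+ 2.
  move=> a0 ua; rewrite -(real_normK (num_real (u / L))).
  rewrite lerXn2r ?nnegrE ?divr_ge0 ?(ltW L0) //.
  by rewrite normf_div (gtr0_norm L0) ler_pM2r // invr_gt0.
have p_ge0 (u : R) : `|u| <= L -> 0 <= p.[u].
  move=> uL; rewrite pE subr_ge0 (le_trans (sqr_le _ _ (ltW L0) uL)) //.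
  by rewrite divff ?gt_eqF // expr1n.
pose F m := sval (cid (ex_antideriv (p ^+ m))).
have FE m : (F m)^`() = p ^+ m by exact: (svalP (cid (ex_antideriv (p ^+ m)))).
pose N m := (F m).[L] - (F m).[- L].
have F_mono m (a b : R) : - L <= a -> a <= b -> b <= L -> (F m).[a] <= (F
  m).[b].
  move=> La ab bL; rewrite -subr_ge0.
  have [u /andP[au ub] ->] := horner_mean_value (F m) ab.
  rewrite mulr_ge0 ?subr_ge0 // FE horner_exp exprn_ge0 // p_ge0 // ler_norml.
  by rewrite (le_trans La au) (le_trans ub bL).
(* The mass on [0, a] alone is a lower bound, and there the kernel is at least its value at [a]. *)
have N_ge m (a : R) : 0 < a -> a <= L -> a * (1 - (a / L) ^+ 2) ^+ m <= N m.
  move=> a0 aL.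
  have [u /andP[u0 ua] E] := horner_mean_value (F m) (ltW a0).
  rewrite FE horner_exp subr0 pE in E.
  have h1 : (F m).[a] <= (F m).[L].
    by apply: F_mono => //; rewrite (le_trans _ (ltW a0)) // oppr_le0 ltW.
  have h2 : (F m).[- L] <= (F m).[0].
    by apply: F_mono => //; [rewrite oppr_le0|]; exact: ltW.
  have h3 : a * (1 - (a / L) ^+ 2) ^+ m <= (1 - (u / L) ^+ 2) ^+ m * a.
    rewrite mulrC ler_pM2r // lerXn2r ?nnegrE.
    - by [].
    - by rewrite -pE p_ge0 // gtr0_norm.
    - rewrite -pE p_ge0 // ger0_norm //; exact: le_trans ua aL.
    - by rewrite lerB // sqr_le ?(ltW a0) // ger0_norm.
  by rewrite /N; lra.
have Lh : 0 < L / 2 by rewrite divr_gt0.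
have base_gt0 (a : R) : 0 < a -> a < L -> 0 < 1 - (a / L) ^+ 2.
  move=> a0 aL; rewrite subr_gt0 exprn_ilt1 ?divr_ge0 ?ltW //.
  by rewrite ltr_pdivrMr // mul1r.
have N_gt0 m : 0 < N m.
  have LhL : L / 2 < L by rewrite ltr_pdivrMr // ltr_pMr // ltr1n.
  apply: lt_le_trans (N_ge m _ Lh (ltW LhL)).
  by rewrite mulr_gt0 // exprn_gt0 // base_gt0.
exists (fun m => (N m)^-1 *: p ^+ m), (fun m => (N m)^-1 *: F m); split.
- by move=> m; rewrite derivZ FE.
- by move=> m; rewrite !hornerZ -mulrBr mulVf // gt_eqF.
- move=> m u uL; rewrite hornerZ horner_exp mulr_ge0 ?invr_ge0 ?exprn_ge0 //.
    exact: ltW.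
  exact: p_ge0.
move=> delta eta d0 e0; have [dL|Ld] := lerP delta L; last first.
  by apply: nearW => m u /andP[du uL]; move: (lt_le_trans Ld du); rewrite ltNge
    uL.
(* Any [a] strictly between 0 and [delta] would do. Beyond [delta] the power is at most (1 -
   (delta/L)^2)^m, and the mass is at least a (1 - (a/L)^2)^m. The quotient is rho^m / a with rho <
   1, hence the threshold [eta * a] for rho^m. *)
pose a := delta / 2.
have a0 : 0 < a by rewrite divr_gt0.
have ad : a < delta by rewrite ltr_pdivrMr // ltr_pMr // ltr1n.
have aL : a < L := lt_le_trans ad dL.
have ba0 := base_gt0 _ a0 aL.
pose rho := (1 - (delta / L) ^+ 2) / (1 - (a / L) ^+ 2).
have bd0 : 0 <= 1 - (delta / L) ^+ 2.
  by rewrite -pE p_ge0 // gtr0_norm.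
have rho0 : 0 <= rho by rewrite divr_ge0 // ltW.
have rho1 : `|rho| < 1.
  rewrite ger0_norm // ltr_pdivrMr // mul1r ltrD2l ltrN2.
  rewrite ltr_pXn2r ?nnegrE ?divr_ge0 ?(ltW L0) ?(ltW a0) ?(ltW d0) //.
  by rewrite ltr_pM2r // invr_gt0.
have ea0 : 0 < eta * a by rewrite mulr_gt0.
have := cvg_expr rho1 => /cvgrPdist_le /(_ _ ea0); apply: filterS => m.
rewrite sub0r normrN ger0_norm ?exprn_ge0 // => rm u /andP[du uL].
rewrite hornerZ horner_exp ler_pdivrMl // pE.
apply: (@le_trans _ _ ((1 - (delta / L) ^+ 2) ^+ m)).
  have up : 0 <= 1 - (u / L) ^+ 2 by rewrite -pE p_ge0.
  rewrite lerXn2r ?nnegrE // lerD2l lerN2 -(real_normK (num_real (u / L))).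
  rewrite lerXn2r ?nnegrE ?divr_ge0 ?(ltW L0) ?(ltW d0) //.
  by rewrite normf_div (gtr0_norm L0) ler_pM2r ?invr_gt0.
apply: (@le_trans _ _ (a * (1 - (a / L) ^+ 2) ^+ m * eta)); last first.
  by rewrite ler_pM2r // N_ge // ltW.
move: rm; rewrite /rho expr_div_n ler_pdivrMr ?exprn_gt0 //.
move=> /le_trans; apply; rewrite (_ : _ * a * _ = a * (1 - (a / L) ^+ 2) ^+ m *
  eta) //; ring.
Qed.

(** * Uniform error of the polynomial convolution on a compact set *)

Section Approximation.
Context {R : realType} {n d : nat}.
Implicit Types (c : 'I_(n * d)) (x : 'M[R]_(n, d)) (g : 'M[R]_(n, d) -> R)
  (V : set 'M[R]_(n, d)).

(** The updated point may leave [V], so uniform continuity of [g] on [V] is not enough. Instead, [h]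
    vanishes at every pair (x, x_c), and compactness of [V] makes its continuity there uniform. *)
Lemma upd_modulus V c g (e : R) : compact V -> continuous g -> 0 < e ->
  exists2 delta, 0 < delta & forall x (s : R), V x ->
    `|entry c x - s| < delta -> `|g x - g (upd c s x)| <= e.
Proof.
move=> Vc gc e0.
pose h (p : 'M[R]_(n, d) * R) := g p.1 - g (upd c p.2 p.1).
have hc : continuous h.
  apply: cts_sub.
    exact: (cts_comp (@cts_fst 'M[R]_(n, d) R) gc).
  exact: (cts_comp (@upd_cts2 R n d c) gc).
pose P (delta : R) x := forall s, `|entry c x - s| < delta -> `|h (x, s)| <= e.
suff nP : \forall delta \near 0^'+, V `<=` P delta.
  have [delta [d0 dP]] := filter_ex (filterI (nbhs_right_gt (0 : R)) nP).
  by exists delta => // x s Vx xs; exact: (dP x Vx s xs).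
apply: (compact_near_coveringP _).1 => [//|x0 _].
have [[U W] /= [xU sW] UW] : \forall p \near (x0, entry c x0), `|h (x0, entry c
  x0) - h p| < e.
  by have /cvgrPdist_lt /(_ _ e0) := hc (x0, entry c x0).
have [r /= r0 rW] := (nbhs_ballP _ _).1 sW.
have r20 : 0 < r / 2 by rewrite divr_gt0.
exists (U `&` [set x | `|entry c x0 - entry c x| < r / 2], [set delta | delta <
  r / 2]).
  split=> /=; last exact: nbhs_right_lt.
  apply: filterI => //.
  by have /cvgrPdist_lt /(_ _ r20) := @entry_cts R n d c x0.
move=> [x delta] [/= [Ux x0x] dr] s xs.
have -> : h (x, s) = - (h (x0, entry c x0) - h (x, s)).
  by rewrite {2}/h /= upd_id subrr sub0r opprK.
rewrite normrN ltW //; apply: (UW (x, s)); split=> //=; apply: rW.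
rewrite /ball /= -(subrKA (entry c x)) (le_lt_trans (ler_normD _ _)) //.
by rewrite (splitr r) ltrD // (lt_trans xs).
Qed.

Lemma upd_bounded V c g (A : R) : compact V -> continuous g ->
  exists2 C, 0 < C & forall x (s : R), V x -> - A <= s <= A ->
    `|g (upd c s x)| <= C.
Proof.
move=> Vc gc.
pose h (p : 'M[R]_(n, d) * R) := g (upd c p.2 p.1).
have hc : continuous h := cts_comp (@upd_cts2 R n d c) gc.
have := compact_setX Vc (@segment_compact _ (- A) A).
move=> /(continuous_compact (@continuous_subspaceT _ _ _ _ hc)).
move=> /compact_bounded bh.
have [C [C0 CP]] := filter_ex (filterI (nbhs_pinfty_gt (num_real (0 : R))) bh).
exists C => // x s Vx sA; by apply: CP => /=; exists (x, s).
Qed.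

Lemma symint_norm_le_symint (A : R) (f h : R -> R) : continuous f ->
  continuous h -> (forall s, - A <= s <= A -> `|f s| <= h s) ->
  `|symint A f| <= symint A h.
Proof.
move=> fc hc fh; rewrite ler_norml; apply/andP; split; last first.
  by apply: le_symint => // s /fh; rewrite ler_norml => /andP[].
rewrite -[- symint A h]mulN1r -symintZ //; apply: le_symint => // [|s /fh].
  by apply: (cts_mul _ hc); exact: cst_continuous.
by rewrite mulN1r ler_norml => /andP[].
Qed.

(** With A = B + 1 and Q the mass of [K.[y - s]] over [-A, A], the error is g(x) (1 - Q) plus the
    integral of (g(x) - g(upd c s x)) K(y - s). The first term is at most 4 C A eta, the second at
    most e1 + 4 C A eta, which gives the factor 8. *)
Lemma pconv_error (B e1 eta C delta : R) c g (K Phi : {poly R}) x :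
  0 < B -> 0 < delta -> delta <= 1 -> 0 <= e1 -> 0 <= C -> continuous g ->
  Phi^`() = K -> Phi.[(B + 1) *+ 2] - Phi.[- ((B + 1) *+ 2)] = 1 ->
  (forall u, `|u| <= (B + 1) *+ 2 -> 0 <= K.[u]) ->
  (forall u, delta <= `|u| <= (B + 1) *+ 2 -> K.[u] <= eta) ->
  (forall s, `|entry c x - s| < delta -> `|g x - g (upd c s x)| <= e1) ->
  (forall s, - (B + 1) <= s <= B + 1 -> `|g (upd c s x)| <= C) ->
  `|entry c x| <= B ->
  `|g x - pconv (B + 1) c K g x| <= e1 + eta * (C * (B + 1) *+ 8).
Proof.
set A := B + 1; set y := entry c x.
move=> B0 d0 d1 e10 C0 gc PhiK PhiL K0 Keta ge gC yB.
have A0 : 0 < A by rewrite /A; lra.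
move: yB; rewrite ler_norml => /andP[By yB].
have Kc : continuous (fun s : R => K.[y - s]).
  exact: (cts_horner_sub (@cst_continuous R R y) (@cts_id R)).
have eta0 : 0 <= eta.
  apply: le_trans (Keta (A *+ 2) _); first by rewrite K0 // ger0_norm // /A;
    lra.
  by rewrite ger0_norm /A; lra.
pose Q := symint A (fun s => K.[y - s]).
have QE : Q = Phi.[y + A] - Phi.[y - A].
  have PD (s : R) : is_derive s (1 : R) (fun s => - Phi.[y - s]) K.[y - s].
    rewrite -PhiK -[Phi^`().[_]]opprK.
    exact: is_deriveN (is_derive_horner_sub Phi y s).
  by rewrite /Q (symint_FTC A0 Kc PD) !opprK addrC.
(* The missing mass is that of [K] on [y + A, 2A] and [-2A, y - A]. Since |y| <= A - 1, both
   intervals have distance at least 1, hence at least [delta], from 0; their total length is 2A. *)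
have Q1 : 0 <= 1 - Q <= eta * (A *+ 4).
  have [|u /andP[u1 u2] E1] := @horner_mean_value _ Phi (y + A) (A *+ 2).
    by rewrite /A; lra.
  have [|v /andP[v1 v2] E2] := @horner_mean_value _ Phi (- (A *+ 2)) (y - A).
    by rewrite /A; lra.
  rewrite PhiK in E1 E2.
  have Ku : 0 <= K.[u] <= eta.
    by rewrite K0 ?Keta //; rewrite ger0_norm; rewrite /A in u1 u2 *; lra.
  have Kv : 0 <= K.[v] <= eta.
    by rewrite K0 ?Keta //; rewrite ler0_norm; rewrite /A in v1 v2 *; lra.
  have -> : 1 - Q = K.[u] * (A *+ 2 - (y + A)) + K.[v] * (y - A - - (A *+ 2)).
    by rewrite QE -E1 -E2 -PhiL; ring.
  have yA : - A <= y <= A by rewrite /A; lra.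
  by nra.
have hc : continuous (fun s => (g x - g (upd c s x)) * K.[y - s]).
  apply: (cts_mul _ Kc); apply: cts_sub; first exact: cst_continuous.
  exact: (cts_comp (@upd_continuous_l _ _ _ c x) gc).
have gKc : continuous (fun s => g (upd c s x) * K.[y - s]).
  by apply: (cts_mul _ Kc); exact: (cts_comp (@upd_continuous_l _ _ _ c x) gc).
have gC' : `|g x| <= C.
  by have := gC y; rewrite upd_id; apply; rewrite /A; lra.
have -> : g x - pconv A c K g x = g x * (1 - Q) +
    symint A (fun s => (g x - g (upd c s x)) * K.[y - s]).
  have -> : (fun s => (g x - g (upd c s x)) * K.[y - s]) =
      fun s => g x * K.[y - s] - g (upd c s x) * K.[y - s].
    by apply/funext => s; ring.
  rewrite symintB //; last by apply: (cts_mul _ Kc); exact: cst_continuous.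
  by rewrite symintZ // /pconv -/Q; ring.
(* The integrand is at most e1 K when [y - s] is within [delta] of 0, and at most 2 C eta otherwise.
   Adding the two bounds avoids splitting the integral. *)
have I1 : `|symint A (fun s => (g x - g (upd c s x)) * K.[y - s])| <=
    e1 * Q + C *+ 2 * eta * (A *+ 2).
  have -> : e1 * Q + C *+ 2 * eta * (A *+ 2) =
      symint A (fun s => e1 * K.[y - s] + C *+ 2 * eta).
    rewrite symintD; last exact: cst_continuous.
      by rewrite symintZ // symint_cst.
    by apply: (cts_mul _ Kc); exact: cst_continuous.
  apply: symint_norm_le_symint => //.
    move=> s; apply: (@continuousD _ _ _ (fun s => e1 * K.[y - s]) (cst (C *+ 2
      * eta))).
      by apply: (cts_mul _ Kc); exact: cst_continuous.
    exact: cst_continuous.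
  move=> s sA.
  have ys : `|y - s| <= A *+ 2 by rewrite ler_norml /A in sA *; lra.
  have Kys := K0 _ ys.
  rewrite normrM (ger0_norm Kys).
  have [lt|ge'] := ltrP `|y - s| delta.
    have := ge _ lt => h; have Ce : 0 <= C *+ 2 * eta by rewrite mulr_ge0
      ?mulrn_wge0.
    by nra.
  have Ke : K.[y - s] <= eta by apply: Keta; rewrite ge'.
  have := ler_normB (g x) (g (upd c s x)); have := gC _ sA => h1 h2.
  have h3 : `|g x - g (upd c s x)| <= C *+ 2 by rewrite mulr2n (le_trans h2) //
    lerD.
  have h4 := normr_ge0 (g x - g (upd c s x)).
  have h5 : 0 <= e1 * K.[y - s] by rewrite mulr_ge0.
  by nra.
have I2 : `|g x * (1 - Q)| <= C * (eta * (A *+ 4)).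
  rewrite normrM ler_pM // ger0_norm; by case/andP: Q1.
have Qle1 : e1 * Q <= e1 by case/andP: Q1 => *; nra.
rewrite (le_trans (ler_normD _ _)) //; move: I1 I2 Qle1; lra.
Qed.

Lemma pconv_approx V c g (B e : R) (K Phi : nat -> {poly R}) :
  compact V -> continuous g -> 0 < B -> (forall x, V x -> `|entry c x| <= B) ->
  0 < e -> (forall m, (Phi m)^`() = K m) ->
  (forall m, (Phi m).[(B + 1) *+ 2] - (Phi m).[- ((B + 1) *+ 2)] = 1) ->
  (forall m (u : R), `|u| <= (B + 1) *+ 2 -> 0 <= (K m).[u]) ->
  (forall delta eta : R, 0 < delta -> 0 < eta -> \forall m \near \oo,
    forall u : R, delta <= `|u| <= (B + 1) *+ 2 -> (K m).[u] <= eta) ->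
  \forall m \near \oo, forall x, V x ->
    `|g x - pconv (B + 1) c (K m) g x| <= e.
Proof.
move=> Vc gc B0 VB e0 PhiK PhiL K0 Keta.
have e20 : 0 < e / 2 by rewrite divr_gt0.
have [delta d0 dP] := upd_modulus c Vc gc e20.
have [C C0 CP] := upd_bounded c (B + 1) Vc gc.
have D0 : 0 < C * (B + 1) *+ 8 by rewrite mulrn_wgt0 // mulr_gt0 // addr_gt0.
have m0 : 0 < Num.min delta 1 by rewrite lt_min d0 ltr01.
have eta0 : 0 < e / 2 / (C * (B + 1) *+ 8) by rewrite divr_gt0.
apply: filterS (Keta _ _ m0 eta0) => m Km x Vx.
have := @pconv_error B (e / 2) (e / 2 / (C * (B + 1) *+ 8)) C (Num.min delta 1)
  c g (K m) (Phi m) x.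
rewrite divfK ?gt_eqF // -splitr; apply=> //.
- by rewrite ge_min lexx orbT.
- exact: ltW.
- exact: ltW.
- exact: K0.
- by move=> s; rewrite lt_min => /andP[xs _]; exact: dP.
- by move=> s; exact: CP.
- exact: VB.
Qed.

End Approximation.

(** * Uniform approximation of derivatives *)

Section CkApproximation.
Context {R : realType} {n d : nat}.
Implicit Types (c : 'I_(n * d)) (x : 'M[R]_(n, d)) (F G H : 'M[R]_(n, d) -> R)
  (V : set 'M[R]_(n, d)).

Fixpoint Ck_le k V (e : R) H : Prop :=
  (forall x, V x -> `|H x| <= e) /\
  match k with
  | 0%N => True
  | k'.+1 => forall c, Ck_le k' V e (partial c H)
  end.

(** Smoothness on the whole space gives an equality of functions, not merely of values on a set, so
    it can be rewritten under further derivatives. *)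
Lemma partial_add k F G c : Ck_on k.+1 setT F -> Ck_on k.+1 setT G ->
  partial c (F + G) = partial c F + partial c G.
Proof.
move=> FC GC; apply/funext => x.
have [_ E] := is_deriveD (Ck_on_is_derive (x := x) c FC I)
  (Ck_on_is_derive (x := x) c GC I).
exact: E.
Qed.

Lemma Ck_le_add k V e1 e2 F G : Ck_on k setT F -> Ck_on k setT G ->
  Ck_le k V e1 F -> Ck_le k V e2 G -> Ck_le k V (e1 + e2) (F + G).
Proof.
elim: k F G => [|k IH] F G FC GC [Fe FP] [Ge GP].
  by split=> // x Vx; rewrite (le_trans (ler_normD _ _)) // lerD ?Fe ?Ge.
split=> [x Vx|c].
  by rewrite (le_trans (ler_normD _ _)) // lerD ?Fe ?Ge.
rewrite (partial_add c FC GC); apply: IH; first exact: Ck_on_partial.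
- exact: Ck_on_partial.
- exact: FP.
- exact: GP.
Qed.

Lemma Ck_on_scale k (a : R) F :
  Ck_on k setT F -> Ck_on k setT (fun x => a * F x).
Proof.
move=> FC; apply: (@Ck_onM _ _ _ k setT (cst a)) => //; first exact: openT.
exact: Ck_on_cst openT.
Qed.

Lemma Ck_on_sub k F G : Ck_on k setT F -> Ck_on k setT G ->
  Ck_on k setT (fun x => F x - G x).
Proof.
move=> FC GC; rewrite (_ : (fun _ => _) = F + (fun x => - 1 * G x)).
  by apply: Ck_onD => //; [exact: openT|exact: Ck_on_scale].
by apply/funext => x; rewrite fctE mulN1r.
Qed.

Lemma partial_scale k (a : R) F c : Ck_on k.+1 setT F ->
  partial c (fun x => a * F x) = fun x => a * partial c F x.
Proof.
move=> FC; apply/funext => x.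
have [_ E] := is_deriveZ a (Ck_on_is_derive (x := x) c FC I).
exact: E.
Qed.

Lemma Ck_le_scale k V e (a : R) F : `|a| <= 1 -> Ck_on k setT F ->
  Ck_le k V e F -> Ck_le k V e (fun x => a * F x).
Proof.
move=> a1; elim: k F => [|k IH] F FC [Fe FP].
  split=> // x Vx; rewrite normrM (le_trans _ (Fe _ Vx)) //.
  by rewrite ler_piMl.
split=> [x Vx|c].
  rewrite normrM (le_trans _ (Fe _ Vx)) //; exact: ler_piMl.
rewrite (partial_scale a c FC); apply: IH; last exact: FP.
exact: Ck_on_partial.
Qed.

Lemma Ck_le0 k V e : 0 <= e -> Ck_le k V e (cst 0).
Proof.
move=> e0; elim: k => [|k IH]; split=> //; try by move=> x _; rewrite normr0.
move=> c.
by rewrite (_ : partial c _ = cst 0) //; apply/funext => x; exact: derive_cst.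
Qed.

Lemma Ck_le_sum k V e (I : Type) (r : seq I) (F : I -> 'M[R]_(n, d) -> R) :
  (forall i, Ck_on k setT (F i)) -> (forall i, Ck_le k V e (F i)) ->
  Ck_le k V (e *+ size r) (fun x => \sum_(i <- r) F i x).
Proof.
move=> FC Fe; elim: r => [|i r IH].
  rewrite (_ : (fun _ => _) = cst 0); last by apply/funext => x; rewrite
    big_nil.
  exact: Ck_le0.
rewrite (_ : (fun _ => _) = F i + (fun x => \sum_(j <- r) F j x)).
  by rewrite /= mulrS; apply: Ck_le_add => //; apply: Ck_on_sum => //; exact:
    openT.
by apply/funext => x; rewrite big_cons.
Qed.

Lemma Ck_le_foldr V e (alpha : 'I_(n * d) -> nat) F (s : seq 'I_(n * d)) k :
  Ck_le (k + \sum_(c <- s) alpha c) V e F ->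
  Ck_le k V e (foldr (fun c g => iter (alpha c) (partial c) g) F s).
Proof.
elim: s k => [|c s IH] k /=; first by rewrite big_nil addn0.
rewrite big_cons addnA => /IH; elim: (alpha c) k => [|m IHm] k /=.
  by rewrite addn0.
by rewrite addnS -addSn => /IHm[_ /(_ c)].
Qed.

Lemma sum_max_derivs_le k V e F : 0 <= e -> Ck_le k V e F ->
  sum_max_derivs k V F <= e *+ #|{: mpoly.bmultinom (n * d) k.+1}|.
Proof.
move=> e0 Fe; rewrite /sum_max_derivs -sumr_const; apply: ler_sum => alpha _.
(* For empty [V] each supremum is 0 by convention. *)
have [->|/set0P Vn] := eqVneq V set0; first by rewrite image_set0 sup0.
apply: ge_sup; first by case: Vn => x Vx; exists `|multi_deriv alpha F x|, x.
move=> _ [x Vx <-].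
have := @Ck_le_foldr V e alpha F (enum 'I_(n * d)) (k - mpoly.mdeg alpha).
rewrite big_enum /= -mpoly.mdegE subnK; last by have := mpoly.bmdeg alpha.
move=> /(_ Fe); case: (k - _)%N => [|?] [h _]; exact: h.
Qed.

(** The strict inequality makes the region open, so that all partial derivatives vanish on it
    too. *)
Definition vanishes (B : R) c F := forall x, B < `|entry c x| -> F x = 0.

Lemma vanishes_partial B c c' F : vanishes B c F -> vanishes B c (partial c' F).
Proof.
move=> FB x Bx; rewrite /partial -(derive_cst (0 : R) x (coord_vec R c')).
apply: near_eq_derive.
have hc : {for x, continuous (fun y => `|entry c y|)}.
  apply: (@continuous_comp _ _ _ (entry c) Num.norm); first exact: entry_cts.
  exact: (@norm_continuous R R (entry c x)).
have Fx := @nbhs_filter 'M[R]_(n, d) x.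
have := @cvgr_gt _ _ (nbhs x) Fx _ _ hc B Bx.
by apply: filterS => y; exact: FB.
Qed.

Lemma is_derive_pconv B c c' K k F x : 0 < B -> Ck_on k.+1 setT F ->
  vanishes B c F ->
  is_derive x (coord_vec R c') (pconv (B + 1) c K F)
    (pconv (B + 1) c K (partial c' F) x).
Proof.
move=> B0 FC FB; apply: pconv_derive.
- by rewrite addr_gt0.
- by move=> y; exact: (Ck_on_continuous FC).
- by move=> y; exact: (Ck_on_continuous (Ck_on_partial c' FC)).
- by move=> y; exact: Ck_on_is_derive FC I.
- by move=> y By; apply: FB; rewrite (lt_le_trans _ By) // ltrDl.
Qed.

Lemma Ck_on_pconv B c K k F : 0 < B -> Ck_on k setT F -> vanishes B c F ->
  Ck_on k setT (pconv (B + 1) c K F).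
Proof.
move=> B0; have A0 : 0 < B + 1 by rewrite addr_gt0.
elim: k F => [|k IH] F FC FB.
  split=> // x _; apply: pconv_continuous => // y.
  exact: (Ck_on_continuous FC).
apply: (@Ck_on_intro _ _ _ _ _ _ (fun c' => pconv (B + 1) c K (partial c' F))).
- exact: openT.
- move=> x _; apply: pconv_continuous => // y; exact: (Ck_on_continuous FC).
- by move=> c' x _; exact: is_derive_pconv FC FB.
- move=> c'; apply: IH; first exact: Ck_on_partial.
  exact: vanishes_partial.
Qed.

Lemma partial_pconv B c c' K k F : 0 < B -> Ck_on k.+1 setT F ->
  vanishes B c F ->
  partial c' (pconv (B + 1) c K F) = pconv (B + 1) c K (partial c' F).
Proof.
move=> B0 FC FB; apply/funext => x.
by have [_] := is_derive_pconv c' K x B0 FC FB.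
Qed.

Lemma vanishes_pconv B c c' K F : 0 < B -> c' != c -> vanishes B c' F ->
  vanishes B c' (pconv (B + 1) c K F).
Proof.
move=> B0 cc' FB x Bx; rewrite /pconv (_ : (fun _ => _) = cst 0).
  by rewrite symint_cst ?mul0r // addr_gt0.
by apply/funext => s; rewrite FB ?mul0r // entry_upd (negbTE cc').
Qed.

Section Iteration.
Context (V : set 'M[R]_(n, d)) (B : R) (K Phi : nat -> {poly R}).
Context (Vc : compact V).
Context (B0 : 0 < B).
Context (VB : forall c x, V x -> `|entry c x| <= B).
Context (PhiK : forall m, (Phi m)^`() = K m).
Context (PhiL :
  forall m, (Phi m).[(B + 1) *+ 2] - (Phi m).[- ((B + 1) *+ 2)] = 1).
Context (K0 : forall m (u : R), `|u| <= (B + 1) *+ 2 -> 0 <= (K m).[u]).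
Context (Keta : forall delta eta : R, 0 < delta -> 0 < eta ->
  \forall m \near \oo, forall u : R,
    delta <= `|u| <= (B + 1) *+ 2 -> (K m).[u] <= eta).

(** Convolution commutes with [partial c'], so a derivative of the error is the error for the
    derivative, and induction on [k] applies. There are finitely many coordinates, so one [m]
    eventually serves all of them. *)
Lemma Ck_pconv_approx k c F e : Ck_on k setT F -> vanishes B c F -> 0 < e ->
  \forall m \near \oo, Ck_le k V e (fun x => F x - pconv (B + 1) c (K m) F x).
Proof.
move=> FC FB e0.
have C0 G j : Ck_on j setT G -> \forall m \near \oo, forall x, V x ->
    `|G x - pconv (B + 1) c (K m) G x| <= e.
  move=> GC; apply: (pconv_approx Vc _ B0 (@VB c) e0 PhiK PhiL K0 Keta) => x.
  exact: (Ck_on_continuous GC).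
elim: k F FC FB => [|k IH] F FC FB.
  by apply: filterS (C0 _ _ FC) => m Fm.
have Pnear : \forall m \near \oo, forall c', Ck_le k V e (fun x =>
    partial c' F x - pconv (B + 1) c (K m) (partial c' F) x).
  apply: filter_forall => c'; apply: IH; first exact: Ck_on_partial.
  exact: vanishes_partial.
apply: filterS2 (C0 _ _ FC) Pnear => m Fm Pm; split=> // c'.
rewrite (_ : partial _ _ = fun x => partial c' F x -
    pconv (B + 1) c (K m) (partial c' F) x) //.
rewrite (_ : (fun x => F x - pconv (B + 1) c (K m) F x) =
    F + (fun x => - 1 * pconv (B + 1) c (K m) F x)); last first.
  by apply/funext => x; rewrite fctE mulN1r.
have PC := Ck_on_pconv (K m) B0 FC FB.
rewrite (partial_add c' FC (Ck_on_scale _ PC)) (partial_scale _ c' PC).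
rewrite (partial_pconv c' (K m) B0 FC FB).
by apply/funext => x; rewrite fctE mulN1r.
Qed.

(** The invariant that makes the induction work is vanishing in the coordinates outside [s]: the
    next coordinate still has it when it is convolved, and loses it only then. Hence [s] must be
    free of repetitions. *)
Lemma Ck_poly_in_approx k F e (s : seq 'I_(n * d)) : uniq s ->
  Ck_on k setT F -> (forall c, vanishes B c F) -> 0 < e ->
  exists G, [/\ Ck_on k setT G, poly_in s G,
    forall c, c \notin s -> vanishes B c G &
    Ck_le k V e (fun x => F x - G x)].
Proof.
move=> + FC FB; elim: s e => [|c s IH] e; last first.
  move=> /= /andP[cs us] e0; have e20 : 0 < e / 2 by rewrite divr_gt0.
  have [G [GC Gs GB FG]] := IH _ us e20.
  have [m Gm] := filter_ex (Ck_pconv_approx GC (GB _ cs) e20).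
  have PC := Ck_on_pconv (K m) B0 GC (GB _ cs).
  exists (pconv (B + 1) c (K m) G); split => //.
  - by apply: poly_in_pconv => //; rewrite addr_gt0.
  - move=> c'; rewrite inE negb_or => /andP[c'c c's].
    by apply: vanishes_pconv => //; exact: GB.
  - rewrite (splitr e) (_ : (fun _ => _) = (fun x => F x - G x) +
      (fun x => G x - pconv (B + 1) c (K m) G x)).
      by apply: Ck_le_add => //; exact: Ck_on_sub.
    by apply/funext => x; rewrite fctE subrKA.
move=> _ e0; exists F; split=> //.
  by apply: poly_in_base => // x; exact: (Ck_on_continuous FC).
rewrite (_ : (fun _ => _) = cst 0); first exact/Ck_le0/ltW.
by apply/funext => x; rewrite subrr.
Qed.

End Iteration.

End CkApproximation.

(** * Permutations of the rows *)

Section RowPermutation.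
Context {R : realType} {n d : nat}.
Implicit Types (c : 'I_(n * d)) (x : 'M[R]_(n, d)) (F : 'M[R]_(n, d) -> R)
  (V : set 'M[R]_(n, d)) (s : 'S_n).

Lemma row_perm_coord_vec s c :
  exists c', row_perm s (coord_vec R c) = coord_vec R c'.
Proof.
case/mxvec_indexP: c => i j; exists (mxvec_index ((s^-1)%g i) j).
rewrite /coord_vec !vec_mx_delta; apply/matrixP => a b; rewrite !mxE.
by rewrite (canF_eq (permK s)).
Qed.

Lemma entry_row_perm s c :
  exists c', forall x, entry c (row_perm s x) = entry c' x.
Proof.
case/mxvec_indexP: c => i j; exists (mxvec_index (s i) j) => x.
by rewrite /entry !mxvecE mxE.
Qed.

Lemma row_perm_cts s : continuous (@row_perm R n d s).
Proof.
move=> x B [P nP PB]; exists (fun i j => P ((s^-1)%g i) j) => [i j|y yP].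
  by have := nP ((s^-1)%g i) j; rewrite /= mxE permKV.
by apply: PB => i j; have := yP (s i) j; rewrite permK mxE.
Qed.

Lemma row_perm_line s (v : 'M[R]_(n, d)) (h : R) x :
  row_perm s (h *: v + x) = h *: row_perm s v + row_perm s x.
Proof. by apply/matrixP => i j; rewrite !mxE. Qed.

(** As [row_perm] is linear, the two difference quotients are the same function of [h]. Derivatives
    thus transfer without a chain rule, and a partial derivative becomes another one because
    coordinate vectors are permuted. *)
Lemma diff_quotient_row_perm s (v : 'M[R]_(n, d)) F x :
  (fun h : R => h^-1 *: (F (row_perm s (h *: v + x)) - F (row_perm s x))) =
  (fun h : R => h^-1 *: (F (h *: row_perm s v + row_perm s x) -
    F (row_perm s x))).
Proof. by apply/funext => h; rewrite row_perm_line. Qed.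

Lemma derive_row_perm s (v : 'M[R]_(n, d)) F x :
  'D_v (fun x => F (row_perm s x)) x = 'D_(row_perm s v) F (row_perm s x).
Proof. by rewrite /derive diff_quotient_row_perm. Qed.

Lemma derivable_row_perm s (v : 'M[R]_(n, d)) F x :
  derivable F (row_perm s x) (row_perm s v) ->
  derivable (fun x => F (row_perm s x)) x v.
Proof. by rewrite /derivable diff_quotient_row_perm. Qed.

Lemma Ck_on_row_perm k s F : Ck_on k setT F ->
  Ck_on k setT (fun x => F (row_perm s x)).
Proof.
have Fs F' : (forall x, setT x -> {for x, continuous F'}) ->
    forall x, setT x -> {for x, continuous (fun x => F' (row_perm s x))}.
  move=> Fc x _; apply: (@continuous_comp _ _ _ (row_perm s) F').
    exact: row_perm_cts.
  exact: Fc.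
elim: k F => [|k IH] F [Fc FD]; first by split=> //; apply: Fs.
split=> [|c]; first exact: Fs.
have [c' E] := row_perm_coord_vec s c; have [Fd FC] := FD c'.
split=> [x _|]; first by apply: derivable_row_perm; rewrite E; exact: Fd.
rewrite (_ : partial _ _ = fun x => partial c' F (row_perm s x)); first exact:
  IH.
by apply/funext => x; rewrite /partial derive_row_perm E.
Qed.

Lemma Ck_le_row_perm k V e s F : (forall x, V x -> V (row_perm s x)) ->
  Ck_le k V e F -> Ck_le k V e (fun x => F (row_perm s x)).
Proof.
move=> Vs; elim: k F => [|k IH] F [Fe FP].
  by split=> // x Vx; apply: Fe; exact: Vs.
split=> [x Vx|c]; first by apply: Fe; exact: Vs.
have [c' E] := row_perm_coord_vec s c.
rewrite (_ : partial _ _ = fun x => partial c' F (row_perm s x)); first by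
  apply: IH; exact: FP.
by apply/funext => x; rewrite /partial derive_row_perm E.
Qed.

Lemma poly_fun_row_perm s (p : mpoly.mpoly (n * d) R) :
  exists q, forall x, poly_fun p (row_perm s x) = poly_fun q x.
Proof.
have [t tP] := choice (entry_row_perm s).
exists (mpoly.comp_mpoly [tuple mpoly.mpolyX R (mpoly.mnm1 (t c)) | c < n * d]
  p).
move=> x; rewrite /poly_fun mpoly.comp_mpoly_meval; apply: mpoly.meval_eq => c.
by rewrite tnth_mktuple mpoly.mevalXU; exact: tP.
Qed.

Lemma poly_fun_sum (I : finType) (a : I -> R)
    (p : I -> mpoly.mpoly (n * d) R) :
  exists q, forall x, poly_fun q x = \sum_i a i * poly_fun (p i) x.
Proof.
exists (\sum_i a i *: p i) => x; rewrite /poly_fun rmorph_sum /=.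
by apply: eq_bigr => i _; rewrite mpoly.mevalZ.
Qed.

End RowPermutation.

(** * Cutoff functions *)

Section Cutoff.
Context {R : realType}.

(* The exponent is [m.+1], which makes [ppow m] a function of class C^m. *)
Definition ppow m (t : R) : R := t ^+ m * Num.max t 0.

Lemma ppow0 m t : t <= 0 -> ppow m t = 0.
Proof. by move=> t0; rewrite /ppow max_r // mulr0. Qed.

Lemma ppow_pos m t : 0 <= t -> ppow m t = t ^+ m.+1.
Proof. by move=> t0; rewrite /ppow max_l // exprSr. Qed.

Lemma ppow_ge0 m t : 0 <= ppow m t.
Proof.
have [t0|/ltW t0] := lerP t 0; first by rewrite ppow0.
by rewrite ppow_pos // exprn_ge0.
Qed.

Lemma ppow_cts m : continuous (ppow m).
Proof.
apply: (@cts_mul _ R (fun t => t ^+ m) (fun t => Num.max t 0)).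
  exact: exprn_continuous.
move=> t; apply: (@continuous_max _ _ id (cst 0)); first by move=> ?.
exact: cst_continuous.
Qed.

Lemma is_derive_ppow m (t : R) :
  is_derive t (1 : R) (ppow m.+1) (m.+2%:R * ppow m t).
Proof.
have [t0|t0|->{t}] := ltgtP t 0.
- rewrite ppow0 ?mulr0 //; last exact: ltW.
  have E : {near t, cst 0 =1 ppow m.+1}.
    by apply: filterS (lt_nbhsl t0) => u /ltW u0; rewrite ppow0.
  exact: (near_eq_is_derive E (is_derive_cst 0 t 1)).
- rewrite ppow_pos; last exact: ltW.
  have E : {near t, (fun u => u ^+ m.+2) =1 ppow m.+1}.
    by apply: filterS (lt_nbhsr t0) => u /ltW u0; rewrite ppow_pos.
  apply: (near_eq_is_derive E).
  have := is_derive_poly 'X^(m.+2) t.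
  rewrite derivXn hornerMn hornerXn mulr_natl.
  by rewrite (_ : horner _ = fun u => u ^+ m.+2) //; apply/funext => u; rewrite
    hornerXn.
rewrite ppow0 // mulr0.
(* At 0 the difference quotient of [ppow m.+1] at step [u] is exactly [ppow m u], which tends to
   0. *)
suff L : (fun u : R => u^-1 *: (ppow m.+1 (u *: (1 : R) + 0) - ppow m.+1 0)) @
  0^' --> (0 : R).
  by split; [apply: cvgP L | apply: cvg_lim L].
have : ppow m u @[u --> 0^'] --> ppow m 0.
  by apply: cvg_within_filter; exact: ppow_cts.
rewrite ppow0 //; apply: cvg_trans; apply: near_eq_cvg.
near=> u; have u0 : u != 0 by near: u; exact: nbhs_dnbhs_neq.
rewrite addr0 (ppow0 _ (lexx 0)) subr0 -[_ *: _]/(u^-1 * _).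
rewrite -[u *: (1 : R)]/(u * 1) mulr1 /ppow exprS -mulrA mulKf //.
Unshelve. all: by end_near. Qed.

Context {n d : nat}.
Implicit Types (c : 'I_(n * d)) (a x : 'M[R]_(n, d)) (F : 'M[R]_(n, d) -> R)
  (U V W C : set 'M[R]_(n, d)).

Lemma Ck_on_subset k U W F : W `<=` U -> Ck_on k U F -> Ck_on k W F.
Proof.
move=> WU; elim: k F => [|k IH] F [Fc FD]; split=> //; try by move=> x /WU;
  exact: Fc.
move=> c; have [Fd FC] := FD c; split; last exact: IH.
by move=> x /WU; exact: Fd.
Qed.

Lemma Ck_on_ppow k m U F : open U -> (k <= m)%N -> Ck_on k U F ->
  Ck_on k U (fun x => ppow m (F x)).
Proof.
move=> Uo; have pc j G : (forall x, U x -> {for x, continuous G}) ->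
    forall x, U x -> {for x, continuous (fun x => ppow j (G x))}.
  move=> Gc x Ux; apply: (@continuous_comp _ _ _ G (ppow j)); first exact: Gc.
  exact: ppow_cts.
elim: k m F => [|k IH] m F km FC.
  by split=> //; apply: pc => x Ux; exact: Ck_on_continuous FC Ux.
case: m km => // m km.
apply: (@Ck_on_intro _ _ _ _ _ _
  (fun c => cst m.+2%:R * (fun x => ppow m (F x)) * partial c F)) => //.
- by apply: pc => x Ux; exact: Ck_on_continuous FC Ux.
- move=> c x Ux; apply: (is_derive_comp1 (is_derive_ppow m (F x))).
  exact: Ck_on_is_derive FC Ux.
- move=> c; apply: Ck_onM => //; last exact: Ck_on_partial.
  apply: Ck_onM => //; first exact: Ck_on_cst.
  by apply: IH => //; exact: Ck_onS.
Qed.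

(** [C] is a closed bounded set carrying [F]: its open complement, together with [U], covers the
    space, which lets products with functions smooth on [U] be extended by zero. The bound [B] later
    yields [vanishes]. *)
Definition small_support k U F := [/\ Ck_on k setT F, forall x, 0 <= F x &
  exists C (B : R), [/\ closed C, C `<=` U, forall x, ~ C x -> F x = 0,
    0 <= B & forall c x, C x -> `|entry c x| <= B]].

Lemma small_support0 k U : small_support k U (cst 0).
Proof.
split=> //; first exact: Ck_on_cst openT.
by exists set0, 0; split=> //; exact: closed0.
Qed.

Lemma small_supportD k U F F' : small_support k U F -> small_support k U F' ->
  small_support k U (F + F').
Proof.
move=> [FC F0 [C [B [Cc CU CF B0 CB]]]] [FC' F0' [C' [B' [Cc' CU' CF' B0'
  CB']]]].
split=> [|x|]; first by apply: Ck_onD => //; exact: openT.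
  by rewrite fctE addr_ge0.
exists (C `|` C'), (B + B'); split.
- exact: closedU.
- by move=> x [/CU|/CU'].
- by move=> x /not_orP[/CF Fx /CF' Fx']; rewrite fctE Fx Fx' addr0.
- exact: addr_ge0.
- move=> c x [/(CB c)|/(CB' c)] /le_trans; apply.
    by rewrite lerDl.
  by rewrite lerDr.
Qed.

Definition box a (r : R) := [set x | forall c, `|entry c x - entry c a| <= r].

Lemma closed_box a r : closed (box a r).
Proof.
rewrite (_ : box a r = \bigcap_c ((fun x => `|entry c x - entry c a|) @^-1`
  [set t | t <= r])).
  apply: closed_bigI => c _; apply: preimage_closed; last exact: closed_le.
  move=> x _; apply: (@continuous_comp _ _ _ (fun x => entry c x - entry c a)
    Num.norm).
    by apply: continuousB; [exact: entry_cts|exact: cst_continuous].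
  exact: (@norm_continuous R R (entry c x - entry c a)).
by apply/seteqP; split=> [x xb c _|x xb c]; [exact: xb|exact: (xb c I)].
Qed.

Lemma box_subset a U : open U -> U a -> exists2 r, 0 < r & box a r `<=` U.
Proof.
move=> Uo Ua; have /nbhs_ballP[r /= r0 rU] : nbhs a U by exact: open_nbhs_nbhs.
exists (r / 2); first by rewrite divr_gt0.
move=> x xb; apply: rU; split=> // i j; have := xb (mxvec_index i j).
rewrite /entry !mxvecE => h; rewrite /ball /= distrC (le_lt_trans h) //.
by rewrite ltr_pdivrMr // ltr_pMr // ltr1n.
Qed.

(** A product over the coordinates of powers of the positive part of r^2 - (x_c - a_c)^2 is
    supported in a box around [a]. It is scaled to the value 2 so that the open set where it exceeds
    1 contains [a]; such sets will cover the compact set. *)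
Lemma ex_bump k a U : open U -> U a ->
  exists2 F, small_support k U F & F a = 2.
Proof.
move=> Uo Ua; have [r r0 rU] := box_subset Uo Ua.
pose G x := \prod_(c < n * d) ppow k (r ^+ 2 - (entry c x - entry c a) ^+ 2).
have GC : Ck_on k setT G.
  apply: (@Ck_on_prod _ _ _ _ _ _ _ (fun c x =>
    ppow k (r ^+ 2 - (entry c x - entry c a) ^+ 2))); first exact: openT.
  move=> c; apply: Ck_on_ppow => //; first exact: openT.
  have E0 : Ck_on k setT (fun x => entry c x - entry c a).
    apply: Ck_on_sub; first exact: Ck_on_entry openT.
    exact: (Ck_on_cst _ _ openT).
  apply: Ck_on_sub; first exact: (Ck_on_cst _ _ openT).
  exact: (Ck_onM openT E0 E0).
have G0 x : 0 <= G x by apply: prodr_ge0 => c _; exact: ppow_ge0.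
have Ga : 0 < G a.
  apply: prodr_gt0 => c _; rewrite subrr expr0n subr0 ppow_pos ?exprn_ge0 ?ltW
    //.
  by rewrite !exprn_gt0.
exists (fun x => 2 / G a * G x); last by rewrite divfK // gt_eqF.
split=> [|x|]; first exact: Ck_on_scale.
  by rewrite mulr_ge0 // divr_ge0 // ltW.
exists (box a r), (r + \sum_c `|entry c a|); split=> //.
- exact: closed_box.
- move=> x /existsNP[c /negP]; rewrite -ltNge => xc.
  suff -> : G x = 0 by rewrite mulr0.
  rewrite /G (bigD1 c) //= ppow0 ?mul0r // subr_le0.
  rewrite -(real_normK (num_real (_ - _))) lerXn2r ?nnegrE ?(ltW r0) //.
  exact: ltW.
- by rewrite addr_ge0 ?(ltW r0) // sumr_ge0.
- move=> c x xb; rewrite -[entry c x](subrK (entry c a)) (le_trans (ler_normD _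
  _)) //.
  rewrite lerD //.
  by rewrite (bigD1 c) //= lerDl sumr_ge0.
Qed.

Lemma ex_cutoff k U V : compact V -> open U -> V `<=` U ->
  exists2 chi, Ck_on k setT chi & [/\ forall x, V x -> chi x = 1 &
  exists C (B : R), [/\ closed C, C `<=` U, forall x, ~ C x -> chi x = 0,
    0 <= B & forall c x, C x -> `|entry c x| <= B]].
Proof.
move=> Vc Uo VU.
have bump a : exists F, V a -> small_support k U F /\ F a = 2.
  have [Va|nVa] := pselect (V a); last by exists (cst 0).
  by have [F ? ?] := ex_bump k Uo (VU _ Va); exists F.
have [psi psiP] := choice bump.
pose O a := [set x | 1 < psi a x].
have psi_cts a : V a -> continuous (psi a).
  by move=> /psiP[[FC _ _] _] x; exact: (Ck_on_continuous FC).
have Oo a : V a -> open (O a).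
  move=> Va; rewrite (_ : O a = psi a @^-1` [set t | 1 < t]) //.
  by apply: open_comp; [move=> x _; exact: psi_cts|exact: open_gt].
have VO : V `<=` cover V O.
  by move=> a Va; exists a => //; rewrite /O /= (psiP _ Va).2 ltr1n.
have := Vc; rewrite compact_cover => /(_ _ V O Oo VO)[D DV VD].
pose S x := \sum_(a <- finmap.enum_fset D) psi a x.
have DV' a : a \in finmap.enum_fset D -> V a by move=> /DV /set_mem.
have SS : small_support k U S.
  rewrite /S -fct_sumE big_seq; elim/big_ind: _.
  - exact: small_support0.
  - exact: small_supportD.
  - by move=> a /DV' Va; case: (psiP _ Va).
have S1 x : V x -> 1 <= S x.
  move=> /VD[a /= aD Ox]; rewrite /S (big_rem a) //=.
  rewrite (le_trans (ltW Ox)) // lerDl big_seq sumr_ge0 // => b.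
  by move=> /mem_rem /DV' /psiP[[_ + _] _]; exact.
case: SS => SC S0 [C [B [Cc CU CS B0 CB]]].
(* Truncates [S] smoothly: where [S >= 1] the positive part of [1 - S] is 0 and the value is 1;
   where [S = 0] it is 1 and the value is 0. *)
exists (fun x => 1 - ppow k (1 - S x)).
  apply: Ck_on_sub; first exact: (Ck_on_cst _ _ openT).
  apply: Ck_on_ppow => //; first exact: openT.
  by apply: Ck_on_sub => //; exact: (Ck_on_cst _ _ openT).
split; first by move=> x Vx; rewrite ppow0 ?subr0 // subr_le0 S1.
exists C, B; split=> // x /CS ->.
by rewrite subr0 ppow_pos // expr1n subrr.
Qed.

Lemma Ck_extension_cutoff k V (f : 'M[R]_(n, d) -> R) :
  compact V -> Ck_fun k V f ->
  exists G (B : R), [/\ Ck_on k setT G, forall x, V x -> G x = f x, 0 < B,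
    forall c x, V x -> `|entry c x| <= B & forall c, vanishes B c G].
Proof.
move=> Vc [F [U [Uo VU FC Ff]]].
have [chi chiC [chi1 [C [B [Cc CU chi0 B0 CB]]]]] := ex_cutoff k Vc Uo VU.
have VC x : V x -> C x.
  move=> Vx; apply: contrapT => /chi0; rewrite chi1 // => /eqP.
  by rewrite oner_eq0.
have CB1 c x : C x -> `|entry c x| <= B + 1.
  by move=> Cx; rewrite (le_trans (CB c x Cx)) // lerDl.
(* [B] may be 0; the added 1 makes the bound positive. *)
exists (chi * F), (B + 1); split.
(* [F] is arbitrary off [U], but there [chi] is zero. On the open set [U] both factors are smooth,
   and on the open complement of [C] the product is zero. *)
- rewrite (_ : setT = U `|` ~` C); last first.
    apply/seteqP; split=> // x _; have [/CU|] := pselect (C x); by [left|right].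
  apply: Ck_onU.
    by apply: Ck_onM => //; exact: Ck_on_subset chiC.
  have Co : open (~` C) by exact: closed_openC.
  apply: (@eq_Ck_on _ _ _ _ _ (cst 0)) => //; last exact: Ck_on_cst.
  by move=> x /chi0 E; rewrite -[RHS]/(chi x * F x) E mul0r.
- by move=> x Vx; rewrite -[LHS]/(chi x * F x) chi1 // mul1r Ff.
- by rewrite ltr_wpDl.
- by move=> c x Vx; apply: CB1; exact: VC.
- move=> c x Bx; rewrite -[LHS]/(chi x * F x) chi0 ?mul0r // => /(CB1 c).
  by rewrite leNgt Bx.
Qed.

End Cutoff.

(** * Compactness of the power, antisymmetrization and conclusion *)

(** A matrix is presented as the row vector of its rows; the regrouping map is continuous, and a
    product of compact sets of rows is compact. *)
Lemma compact_cartesian_power (R : realType) (n d : nat)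
    (Omega : set 'rV[R]_d) :
  compact Omega -> compact (cartesian_power n Omega).
Proof.
move=> Oc; pose rows (v : 'rV['rV[R]_d]_n) : 'M[R]_(n, d) :=
  \matrix_(i, j) v ord0 i ord0 j.
have rows_cts : continuous rows.
  move=> v B [P nP PB].
  exists (fun _ i => [set w : 'rV[R]_d | forall j, P i j (w ord0 j)]) => [a i|w
    wP].
    rewrite ord1 /=; exists (fun _ j => P i j) => [b j|w wP j].
      by rewrite ord1; have := nP i j; rewrite /= mxE.
    exact: wP.
  by apply: PB => i j; rewrite mxE; exact: (wP ord0 i).
rewrite (_ : cartesian_power n Omega =
    rows @` [set v : 'rV['rV[R]_d]_n | forall i, Omega (v ord0 i)]).
  apply: continuous_compact; first exact: continuous_subspaceT.
  exact: (@rV_compact 'rV[R]_d n (fun=> Omega)).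
have rowsE v i : row i (rows v) = v ord0 i.
  by apply/rowP => j; rewrite !mxE.
apply/seteqP; split=> [x xO|_ [v vO <-] i]; last by rewrite rowsE; exact: vO.
exists (\row_i row i x); first by move=> i; rewrite /= mxE; exact: xO.
by apply/matrixP => i j; rewrite !mxE.
Qed.

Lemma cartesian_power_row_perm (R : realType) (n d : nat)
    (Omega : set 'rV[R]_d) (s : 'S_n) x :
  cartesian_power n Omega x -> cartesian_power n Omega (row_perm s x).
Proof.
by move=> xO i; have := xO (s i); congr Omega; apply/rowP => j; rewrite !mxE.
Qed.

(** Reindexing by t -> t s^-1 absorbs [s], and [s^-1] has the same sign as [s]. *)
Lemma antisymmetrized_sum (R : realType) (n d : nat) (F : 'M[R]_(n, d) -> R)
    (s : 'S_n) x :
  \sum_(t : 'S_n) (-1) ^+ t * F (row_perm t (row_perm s x)) =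
  (-1) ^+ s * \sum_(t : 'S_n) (-1) ^+ t * F (row_perm t x).
Proof.
rewrite mulr_sumr (reindex_inj (mulIg (s^-1)%g)) /=.
apply: eq_bigr => t _; rewrite odd_permM odd_permV signr_addb mulrCA mulrA.
congr (_ * _ * F _); rewrite -row_permM.
by rewrite mulgKV.
Qed.

(** [G] is returned along with [p] because the derivatives being bounded are those of [G - p], and
    it is this difference that will be antisymmetrized. *)
Lemma Ck_poly_approx (R : realType) (n d k : nat) (V : set 'M[R]_(n, d))
    (f : 'M[R]_(n, d) -> R) (e : R) : compact V -> Ck_fun k V f -> 0 < e ->
  exists G (p : mpoly.mpoly (n * d) R), [/\ Ck_on k setT G,
    Ck_on k setT (poly_fun p), forall x, V x -> G x = f x &
    Ck_le k V e (fun x => G x - poly_fun p x)].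
Proof.
move=> Vc fC e0; have [G [B [GC Gf B0 VB GB]]] := Ck_extension_cutoff Vc fC.
have L0 : 0 < (B + 1) *+ 2 by rewrite mulrn_wgt0 // addr_gt0.
have [K [Phi [PhiK PhiL K0 Keta]]] := landau_kernels L0.
have [H [HC Hp _ GH]] := @Ck_poly_in_approx _ _ _ V B K Phi Vc B0 VB PhiK PhiL
  K0 Keta k G e (enum 'I_(n * d)) (enum_uniq _) GC GB e0.
have [p E] := poly_in_all (mem_enum 'I_(n * d)) Hp.
by exists G, p; rewrite -E.
Qed.

Theorem theorem15 (R : realType) (n d k : nat) (hn : (2 <= n)%N)
    (hd : (1 <= d)%N) (Omega : set 'rV[R]_d) (hOmega : compact Omega)
    (f : 'M[R]_(n, d) -> R)
    (hanti : antisymmetric_on (cartesian_power n Omega) f)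
    (hCk : Ck_fun k (cartesian_power n Omega) f) :
  forall eps : R, 0 < eps ->
  exists P : mpoly.mpoly (n * d) R,
    antisymmetric_on [set: 'M[R]_(n, d)] (poly_fun P) /\
    (Ck_norm k (cartesian_power n Omega) (fun x => f x - poly_fun P x)%R
      < eps%:E)%E.
Proof.
move=> eps eps0; set V := cartesian_power n Omega.
have Vc : compact V := compact_cartesian_power hOmega.
(* One error for each permutation and each multi-index; the successor makes the final inequality
   strict. *)
pose N := (#|{: 'S_n}| * #|{: mpoly.bmultinom (n * d) k.+1}|).+1.
have e0 : 0 < eps / N%:R by rewrite divr_gt0.
have [G [p [GC pC Gf Gp]]] := Ck_poly_approx Vc hCk e0.
pose N' : R := #|{: 'S_n}|%:R.
have N'1 : 1 <= N' by rewrite ler1n; apply/card_gt0P; exists 1%g.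
have N'0 : N' != 0 by rewrite gt_eqF // (lt_le_trans ltr01).
have [q qP] := choice (fun s : 'S_n => poly_fun_row_perm s p).
have [P PE] := poly_fun_sum (fun s : 'S_n => N'^-1 * (-1) ^+ s) q.
have {}PE x : poly_fun P x =
    N'^-1 * \sum_(s : 'S_n) (-1) ^+ s * poly_fun p (row_perm s x).
  by rewrite PE mulr_sumr; apply: eq_bigr => s _; rewrite qP mulrA.
exists P; split.
  by move=> s x _; rewrite !PE antisymmetrized_sum mulrCA.
pose H (s : 'S_n) x := N'^-1 * (-1) ^+ s *
  (G (row_perm s x) - poly_fun p (row_perm s x)).
have GpC : Ck_on k setT (fun x => G x - poly_fun p x) := Ck_on_sub GC pC.
have HC s : Ck_on k setT (H s) := Ck_on_scale _ (Ck_on_row_perm s GpC).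
(* Of the factor 1/n! only the bound by 1 is used, so each of the n! terms keeps the full error; [N]
   accounts for this. *)
have He s : Ck_le k V (eps / N%:R) (H s).
  apply: Ck_le_scale.
  - rewrite normrM normr_sign mulr1 ger0_norm ?invr_ge0 ?ler0n //.
    by rewrite invf_le1 // (lt_le_trans ltr01).
  - exact: (Ck_on_row_perm s GpC).
  - apply: (Ck_le_row_perm _ Gp) => x; exact: cartesian_power_row_perm.
have ext : Ck_extension k V (fun x => f x - poly_fun P x)
    (fun x => \sum_(s : 'S_n) H s x).
  exists setT; split=> //; first exact: openT.
    by apply: Ck_on_sum => //; exact: openT.
  move=> x Vx; rewrite PE.
  (* On [V], f is the mean of n! copies of itself, and antisymmetry turns the copy of index [s] into
     sgn(s) f(s.x), the matching term of the antisymmetrization. *)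
  have -> : f x = N'^-1 * \sum_(s : 'S_n) f x.
    by rewrite sumr_const -mulr_natl mulrA mulVf // mul1r.
  rewrite -mulrBr -sumrB mulr_sumr; apply: eq_bigr => s _.
  rewrite /H -mulrA mulrBr Gf; last exact: cartesian_power_row_perm.
  by rewrite (hanti s x Vx) mulrA -signr_addb addbb mul1r.
apply: (@le_lt_trans _ _ (sum_max_derivs k V (fun x => \sum_s H s x))%:E).
  by apply: ereal_inf_lbound; exists (fun x => \sum_s H s x).
rewrite lte_fin.
have := Ck_le_sum (index_enum 'S_n) HC He.
rewrite [size _](_ : _ = #|{: 'S_n}|); last by rewrite cardT enumT.
move=> /(sum_max_derivs_le (mulrn_wge0 _ (ltW e0))) /le_lt_trans; apply.
rewrite -mulrnA -(mulr_natr (eps / _)) mulrAC ltr_pdivrMr ?ltr0n //.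
by rewrite ltr_pM2l // ltr_nat.
Qed.
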